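(* The set $\mathcal{S}_1(3) \cap (1/10,1/6]$ has finite symmetric difference with the set $$\{1/10 + 4/(5p) : p \in \mathrm{Prog}(5, 7)\} \cup \{1/10 + 3/(5p) : p \in \mathrm{Prog}(5, 9)\}.$$
   Context: For $x=(x_1,\ldots,x_n) \in (\mathbb{R}/\mathbb{Z})^n$ let $D(x):=\max_k \|x_k-1/2\|$, where $\|\cdot\|$ denotes distance to the nearest integer; for a closed subset $S$ let $D(S):=\min_{x \in S} D(x)$. A subtorus of $(\mathbb{R}/\mathbb{Z})^n$ is a closed connected subgroup; it is proper if it is not contained in the union of the coordinate hyperplanes $\{x_i=0\}$. $\mathcal{S}_1(n)$ is the set of values $D(T)$ as $T$ ranges over the $1$-dimensional proper subtori of $(\mathbb{R}/\mathbb{Z})^n$. $\mathrm{Prog}(\alpha,\beta):=\{\alpha s+\beta : s \in \mathbb{Z}_{\geq 0}\}$. *)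

(* Defs.v *)
From HB Require Import structures.
From mathcomp Require Import all_boot all_order all_algebra.
From mathcomp Require Import all_classical all_reals all_analysis.

Set Implicit Arguments.
Unset Strict Implicit.
Unset Printing Implicit Defensive.

Import Order.TTheory GRing.Theory Num.Theory.
Import numFieldNormedType.Exports.

Local Open Scope classical_set_scope.
Local Open Scope ring_scope.
Local Open Scope quotient_scope.

Definition integers (R : realType) : zmodClosed R :=
  GRing.ZmodClosed.clone R (@Num.int_num_subdef R) _.

(* The group structure of {quot integers R} and the quotient topology live on
   two different type aliases; RmodZ carries both. *)
Definition RmodZ (R : realType) : Type :=
  quotient_topology (Quotient.quot (integers R)).

HB.instance Definition _ (R : realType) := Topological.copy (RmodZ R)
  (quotient_topology (Quotient.quot (integers R))).
HB.instance Definition _ (R : realType) := Quotient.copy (RmodZ R)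
  (Quotient.quot (integers R)).
HB.instance Definition _ (R : realType) := GRing.isZmodule.Build (RmodZ R)
  (@Quotient.addqA R (integers R)) (@Quotient.addqC R (integers R))
  (@Quotient.add0q R (integers R)) (@Quotient.addNq R (integers R)).

Lemma eq_RmodZ (R : realType) (x y : R) :
  \pi_(RmodZ R) x = \pi_(RmodZ R) y <-> x - y \is a Num.int.
Proof.
split; rewrite -[_ \is a _]/(x - y \in integers R) Quotient.idealrBE.
  by move=> eq_xy; apply/eqP.
by move/eqP.
Qed.

Definition nearest_int_dist (R : realType) (y : R) : R :=
  inf [set `|y - k%:~R| | k in [set: int]].

Definition tnorm (R : realType) (x : RmodZ R) : R := nearest_int_dist (repr x).

Lemma tnorm_pi (R : realType) (y : R) :
  tnorm (\pi_(RmodZ R) y) = nearest_int_dist y.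
Proof.
have /eq_RmodZ/intrP[m repr_y] : \pi_(RmodZ R) (repr (\pi_(RmodZ R) y)) =
    \pi_(RmodZ R) y by rewrite reprK.
have {}repr_y : repr (\pi_(RmodZ R) y) = y + m%:~R.
  by rewrite -repr_y addrC subrK.
rewrite /tnorm /nearest_int_dist repr_y; congr (inf _).
apply/seteqP; split=> _ [k _ <-] /=.
  by exists (k - m) => //; rewrite intrB opprB addrA addrAC.
by exists (k + m) => //; rewrite intrD opprD addrACA subrr addr0.
Qed.

(* The matrix topology is the product topology. *)
Notation torus R n := 'rV[RmodZ R]_n.

Definition D (R : realType) (n : nat) (x : torus R n) : R :=
  \big[Num.max/0]_(k < n) tnorm (x ord0 k - \pi_(RmodZ R) (1 / 2)).

Definition is_D_of_set (R : realType) (n : nat) (S : set (torus R n)) (m : R) :=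
  [set D x | x in S] m /\ lbound [set D x | x in S] m.

Definition is_subgroup (V : zmodType) (G : set V) :=
  G 0 /\ forall x y, G x -> G y -> G (x - y).

Definition subtorus (R : realType) (n : nat) (T : set (torus R n)) :=
  [/\ is_subgroup T, closed T & connected T].

(* T is isomorphic to (R/Z)^d as a topological group; psi need only be
   the inverse of phi on T. *)
Definition has_dim (R : realType) (n d : nat) (T : set (torus R n)) :=
  exists (phi : {additive torus R d -> torus R n}) (psi : torus R n -> torus R d),
    [/\ continuous phi, range phi = T, cancel phi psi
      & {within T, continuous psi}].

Definition proper_subtorus (R : realType) (n : nat) (T : set (torus R n)) :=
  subtorus T /\ ~ (T `<=` \bigcup_(i in [set: 'I_n]) [set x | x ord0 i = 0]).

Definition spectrum (R : realType) (d n : nat) : set R :=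
  [set m | exists T : set (torus R n),
     [/\ proper_subtorus T, has_dim d T & is_D_of_set T m]].

Arguments spectrum : clear implicits.

Definition Prog (alpha beta : nat) : set nat :=
  [set (alpha * s + beta)%N | s in [set: nat]].

(* Main.v *)
(* Write the subtorus as {t v} with v a primitive vector of positive integers.  By
   Helly's theorem on the line, D({t v}) <= r iff some m with odd entries satisfies
   |(m x v)_k| <= 2 r (v_i + v_j) for the three pairs {i, j}.  Dirichlet's theorem
   gives a primitive integer relation l . v = 0 that is short compared with v, and the
   vectors m x v with m . l = y lie on a line parallel to l, at spacing 2 l.  For large
   v a point of the line y = 0 (|l|_1 even) or y = 1 (|l|_1 odd, at least 7) shows
   D <= 1/10, while |l|_1 <= 3 odd forces D >= 1/6.  So |l|_1 = 5, which up to
   permutation leaves six families of v.  There D = |w_k|/(2p) with p = v_i + v_j and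
   w_k = p mod 2, that is D = 1/10 + i/(5p) with 2i = -p mod 5, and the points of the
   line y = 1 nearest to the optimum give i < 5; multiplying i and p by 2 or 4 brings
   this to the two progressions.  They are attained by (2, 3, 5s+5) and (1, 4, 5s+8). *)

Require Import Defs.
From HB Require Import structures.
From mathcomp Require Import all_boot all_order all_algebra.
From mathcomp Require Import all_classical all_reals all_analysis.
From mathcomp Require Import zify ring lra.

Import Order.TTheory GRing.Theory Num.Theory.
Import numFieldNormedType.Exports.

Local Open Scope classical_set_scope.
Local Open Scope ring_scope.

(** Along the six families the minimum over all odd [m] is never computed. A minimizing vector turns
    one of its three inequalities into an equality, and the parity of that coordinate alone gives
    the gap the form [1/10 + j/(5s)] with [s] a pair sum. One explicit vector is then enough: it
    bounds the gap by [1/10 + i/(5p)], which only has to be sharp enough to exclude [j >= 5]. Where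
    size leaves [j = 5] open, a congruence modulo 5 closes it. The best point of the line depends on
    the shape of [v]; hence the case splits, in which a neighbouring point replaces [k] by [k + 10]
    or [k - 10]. An odd relation of norm [N] forces the gap up to [1/(2N)]: norm 3 gives the right
    end 1/6 of the interval, norm 5 the left end 1/10. The pigeonhole bound fits into the available
    slack once a coordinate is at least 324; the other lines have gaps of bounded numerator and
    denominator, and so contribute finitely many exceptions. *)

(** * Odd cross products and short relations *)

(* Coordinates of [m x v] for a vector [m] with odd entries. *)
Definition odd_cross (a b c w1 w2 w3 : int) : Prop :=
  exists n1 n2 n3 : int,
    [/\ w1 = (2 * n2 + 1) * c - (2 * n3 + 1) * b,
        w2 = (2 * n3 + 1) * a - (2 * n1 + 1) * c
      & w3 = (2 * n1 + 1) * b - (2 * n2 + 1) * a].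

Definition bezout3 (a b c : int) : Prop :=
  exists u1 u2 u3 : int, u1 * a + u2 * b + u3 * c = 1.

Lemma bezout3_factor (x y z : int) : (x != 0) || (y != 0) || (z != 0) ->
  exists d x' y' z' : int,
    [/\ 0 < d, x = d * x', y = d * y', z = d * z' & bezout3 x' y' z'].
Proof.
move=> nz; have [u [v uv]] := Bezoutz x y.
have [s [t st]] := Bezoutz (gcdz x y) z.
set d := gcdz (gcdz x y) z in st.
have /dvdzP[x' xE] : (d %| x)%Z.
  by apply: dvdz_trans (dvdz_gcdl x y); exact: dvdz_gcdl.
have /dvdzP[y' yE] : (d %| y)%Z.
  by apply: dvdz_trans (dvdz_gcdr x y); exact: dvdz_gcdl.
have /dvdzP[z' zE] : (d %| z)%Z by exact: dvdz_gcdr.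
have d0 : 0 < d by rewrite lt_neqAle; apply/andP; split; [|by []];
  rewrite eq_sym gcdz_eq0 gcdz_eq0 !negb_and.
exists d, x', y', z'; split=> //; try lia.
exists (s * u), (s * v), t; apply: (@mulfI _ d); first by rewrite gt_eqF.
clearbody d; rewrite mulr1 -[RHS]st -uv [in RHS]xE [in RHS]yE [in RHS]zE; ring.
Qed.

(* [u x l] is orthogonal to [l] and [(u x l) x v = l], so adding its multiples
   to [m] moves [m x v] along [l] without changing [m . l]. *)
Lemma odd_cross_shift (a b c l1 l2 l3 w1 w2 w3 k : int) :
  bezout3 a b c -> l1 * a + l2 * b + l3 * c = 0 -> odd_cross a b c w1 w2 w3 ->
  odd_cross a b c (w1 + 2 * k * l1) (w2 + 2 * k * l2) (w3 + 2 * k * l3).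
Proof.
move=> [u1 [u2 [u3 uv]]] lv [n1 [n2 [n3 [-> -> ->]]]].
exists (n1 + k * (u2 * l3 - u3 * l2)), (n2 + k * (u3 * l1 - u1 * l3)),
  (n3 + k * (u1 * l2 - u2 * l1)).
split.
- transitivity ((2 * n2 + 1) * c - (2 * n3 + 1) * b + 2 * k * l1 * (u1 * a + u2 * b + u3 * c)
    - 2 * k * u1 * (l1 * a + l2 * b + l3 * c)); [rewrite uv lv; ring | ring].
- transitivity ((2 * n3 + 1) * a - (2 * n1 + 1) * c + 2 * k * l2 * (u1 * a + u2 * b + u3 * c)
    - 2 * k * u2 * (l1 * a + l2 * b + l3 * c)); [rewrite uv lv; ring | ring].
- transitivity ((2 * n1 + 1) * b - (2 * n2 + 1) * a + 2 * k * l3 * (u1 * a + u2 * b + u3 * c)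
    - 2 * k * u3 * (l1 * a + l2 * b + l3 * c)); [rewrite uv lv; ring | ring].
Qed.

(** For [m] odd with [m . l = y], both [L m - y s] and [v] are orthogonal to [l]. Their cross
    product is therefore a multiple of [l], an integral one because [l] is primitive. Shifts along
    the line change this multiple by [2 L], hence [|k| <= L]. *)
Lemma odd_cross_on_line (a b c l1 l2 l3 s1 s2 s3 y L : int) :
  bezout3 a b c -> bezout3 l1 l2 l3 ->
  l1 * a + l2 * b + l3 * c = 0 -> s1 * l1 + s2 * l2 + s3 * l3 = L -> 0 < L ->
  (exists e, y = l1 + l2 + l3 + 2 * e) ->
  exists w1 w2 w3 k : int, [/\ odd_cross a b c w1 w2 w3, `|k| <= L,
    L * w1 = y * (s2 * c - s3 * b) + k * l1,
    L * w2 = y * (s3 * a - s1 * c) + k * l2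
    & L * w3 = y * (s1 * b - s2 * a) + k * l3].
Proof.
move=> uv [g1 [g2 [g3 gl]]] lv sl L0 [e ye].
pose m1 := 2 * (e * g1) + 1; pose m2 := 2 * (e * g2) + 1.
pose m3 := 2 * (e * g3) + 1.
have ml : m1 * l1 + m2 * l2 + m3 * l3 = y.
  transitivity (l1 + l2 + l3 + 2 * e * (g1 * l1 + g2 * l2 + g3 * l3)).
    rewrite /m1 /m2 /m3; ring.
  by rewrite gl mulr1 -ye.
pose z1 := L * m1 - y * s1; pose z2 := L * m2 - y * s2.
pose z3 := L * m3 - y * s3.
have zl : z1 * l1 + z2 * l2 + z3 * l3 = 0.
  transitivity (L * (m1 * l1 + m2 * l2 + m3 * l3)
                - y * (s1 * l1 + s2 * l2 + s3 * l3)).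
    rewrite /z1 /z2 /z3; ring.
  by rewrite ml sl; ring.
pose C1 := z2 * c - z3 * b; pose C2 := z3 * a - z1 * c.
pose C3 := z1 * b - z2 * a.
have C12 : C1 * l2 = C2 * l1.
  apply/eqP; rewrite -subr_eq0; apply/eqP.
  transitivity (c * (z1 * l1 + z2 * l2 + z3 * l3)
    - z3 * (l1 * a + l2 * b + l3 * c)); last by rewrite zl lv !mulr0 subrr.
  rewrite /C1 /C2; ring.
have C13 : C1 * l3 = C3 * l1.
  apply/eqP; rewrite -subr_eq0; apply/eqP.
  transitivity (- (b * (z1 * l1 + z2 * l2 + z3 * l3)
    - z2 * (l1 * a + l2 * b + l3 * c))); last by rewrite zl lv !mulr0 subrr oppr0.
  rewrite /C1 /C3; ring.
have C23 : C2 * l3 = C3 * l2.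
  apply/eqP; rewrite -subr_eq0; apply/eqP.
  transitivity (a * (z1 * l1 + z2 * l2 + z3 * l3)
    - z1 * (l1 * a + l2 * b + l3 * c)); last by rewrite zl lv !mulr0 subrr.
  rewrite /C2 /C3; ring.
(* Pairing with the Bezout vector [g] of [l] extracts the factor. *)
pose k0 := g1 * C1 + g2 * C2 + g3 * C3.
have k01 : k0 * l1 = C1.
  transitivity (C1 * (g1 * l1 + g2 * l2 + g3 * l3)
    - g2 * (C1 * l2 - C2 * l1) - g3 * (C1 * l3 - C3 * l1)).
    rewrite /k0; ring.
  by rewrite gl C12 C13 !subrr; ring.
have k02 : k0 * l2 = C2.
  transitivity (C2 * (g1 * l1 + g2 * l2 + g3 * l3)
    + g1 * (C1 * l2 - C2 * l1) - g3 * (C2 * l3 - C3 * l2)).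
    rewrite /k0; ring.
  by rewrite gl C12 C23 !subrr; ring.
have k03 : k0 * l3 = C3.
  transitivity (C3 * (g1 * l1 + g2 * l2 + g3 * l3)
    + g1 * (C1 * l3 - C3 * l1) + g2 * (C2 * l3 - C3 * l2)).
    rewrite /k0; ring.
  by rewrite gl C13 C23 !subrr; ring.
pose q := - divz (k0 + L) (2 * L).
have kq : `|k0 + 2 * q * L| <= L.
  have := divz_eq (k0 + L) (2 * L).
  have := @modz_ge0 (k0 + L) (2 * L); have := @ltz_pmod (k0 + L) (2 * L).
  rewrite /q; lia.
have om : odd_cross a b c (m2 * c - m3 * b) (m3 * a - m1 * c) (m1 * b - m2 * a).
  by exists (e * g1), (e * g2), (e * g3).
exists (m2 * c - m3 * b + 2 * q * l1), (m3 * a - m1 * c + 2 * q * l2),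
  (m1 * b - m2 * a + 2 * q * l3), (k0 + 2 * q * L).
split=> //; first exact: (odd_cross_shift _ _ _ _ _ _ _ _ _ q uv lv om).
- rewrite [(k0 + _) * _]mulrDl k01 /C1 /z2 /z3; ring.
- rewrite [(k0 + _) * _]mulrDl k02 /C2 /z1 /z3; ring.
- rewrite [(k0 + _) * _]mulrDl k03 /C3 /z1 /z2; ring.
Qed.

(** Pigeonhole: the [(q + 1)^2] combinations [i a + j b] with [0 <= i, j <= q] cannot all differ
    modulo [c]. *)
Lemma dirichlet2 (a b : int) (c q : nat) : (0 < c)%N -> (c < q.+1 ^ 2)%N ->
  exists x y z : int, [/\ (x != 0) || (y != 0), `|x| <= q, `|y| <= q
    & x * a + y * b + z * c = 0].
Proof.
case: c => // c _ cq.
pose f (i : 'I_q.+1 * 'I_q.+1) : 'I_c.+1 :=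
  inord `|modz ((i.1 : nat)%:Z * a + (i.2 : nat)%:Z * b) c.+1|%N.
have fE i : (f i : nat)%:Z = modz ((i.1 : nat)%:Z * a + (i.2 : nat)%:Z * b) c.+1.
  rewrite /f inordK.
    by rewrite gez0_abs // modz_ge0.
  have := @modz_ge0 ((i.1 : nat)%:Z * a + (i.2 : nat)%:Z * b) c.+1.
  have := @ltz_pmod ((i.1 : nat)%:Z * a + (i.2 : nat)%:Z * b) c.+1; lia.
have /injectivePn[i [j ij fij]] : ~~ injectiveb f.
  apply/negP => /injectiveP /leq_card.
  by rewrite card_prod !card_ord leqNgt mulnn cq.
case: i j ij fij => [i1 i2] [j1 j2] ij fij.
have := congr1 (fun k : 'I_c.+1 => (k : nat)%:Z) fij; rewrite /= !fE /=.
move=> /eqP; rewrite eqz_mod_dvd => /dvdzP[z zE].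
exists ((i1 : nat)%:Z - (j1 : nat)%:Z), ((i2 : nat)%:Z - (j2 : nat)%:Z), (- z).
have := ltn_ord i1; have := ltn_ord i2; have := ltn_ord j1; have := ltn_ord j2.
split; try lia.
rewrite -negb_and; apply: contra ij => /andP[/eqP e1 /eqP e2].
by apply/eqP; congr (_, _); apply/val_inj => /=; lia.
Qed.

(** * The gap of a line *)

(* [near_half t v r]: the coordinate [t v] is within [r] of 1/2 modulo 1; [gap a b c]
   is the minimum of [D] on the line of direction [(a, b, c)]. *)
Definition near_half (R : realFieldType) (t : R) (v : int) (r : R) : Prop :=
  exists n : int, `|t * v%:~R - 1 / 2 - n%:~R| <= r.

Definition gap (R : realFieldType) (a b c : int) (mu : R) : Prop :=
  (exists t, [/\ near_half _ t a mu, near_half _ t b mu & near_half _ t c mu]) /\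
  (forall t r, near_half _ t a r -> near_half _ t b r -> near_half _ t c r -> mu <= r).

Lemma gapC12 (R : realFieldType) (a b c : int) (mu : R) : gap _ a b c mu ->
  gap _ b a c mu.
Proof.
move=> [[t [ta tb tc]] H]; split; first by exists t.
by move=> t' r h1 h2 h3; exact: (H t').
Qed.

Lemma gapC23 (R : realFieldType) (a b c : int) (mu : R) : gap _ a b c mu ->
  gap _ a c b mu.
Proof.
move=> [[t [ta tb tc]] H]; split; first by exists t.
by move=> t' r h1 h2 h3; exact: (H t').
Qed.

(** The quotients are the endpoints of the intervals of [t] on which [t a] is within [r] of
    [x + 1/2], and [t b] within [r] of [y + 1/2]. *)
Lemma intervals_meet (R : realFieldType) (a b : int) (x y r : R) : 0 < a -> 0 < b ->
  `|(2 * x + 1) * b%:~R - (2 * y + 1) * a%:~R| <= 2 * r * (a%:~R + b%:~R) ->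
  (x + 1 / 2 - r) / a%:~R <= (y + 1 / 2 + r) / b%:~R /\
  (y + 1 / 2 - r) / b%:~R <= (x + 1 / 2 + r) / a%:~R.
Proof.
move=> a0 b0; rewrite ler_norml => /andP[h1 h2].
have a0' : 0 < a%:~R :> R by rewrite ltr0z.
have b0' : 0 < b%:~R :> R by rewrite ltr0z.
by split; rewrite ler_pdivrMr // mulrAC ler_pdivlMr //; nra.
Qed.

(* Helly's theorem on the line: pairwise intersection suffices. *)
Lemma odd_cross_near_half (R : realFieldType) (a b c w1 w2 w3 : int) (r : R) :
  0 < a -> 0 < b -> 0 < c -> odd_cross a b c w1 w2 w3 ->
  `|w1|%:~R <= 2 * r * (b + c)%:~R -> `|w2|%:~R <= 2 * r * (a + c)%:~R ->
  `|w3|%:~R <= 2 * r * (a + b)%:~R ->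
  exists t, [/\ near_half _ t a r, near_half _ t b r & near_half _ t c r].
Proof.
move=> a0 b0 c0 [n1 [n2 [n3 [-> -> ->]]]] h1 h2 h3.
have a0' : 0 < a%:~R :> R by rewrite ltr0z.
have b0' : 0 < b%:~R :> R by rewrite ltr0z.
have c0' : 0 < c%:~R :> R by rewrite ltr0z.
have r0 : 0 <= r.
  have : 0 <= 2 * r * (b + c)%:~R by apply: le_trans h1; rewrite ler0z.
  by rewrite pmulr_lge0 ?pmulr_rge0 // ltr0z; lia.
rewrite !intr_norm !(intrB, intrM, intrD) /= in h1 h2 h3.
have [] := @intervals_meet R a b n1%:~R n2%:~R r a0 b0.
  by apply: le_trans h3; rewrite le_eqVlt; apply/orP; left; apply/eqP; congr `| _ |.
have [] := @intervals_meet R a c n1%:~R n3%:~R r a0 c0.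
  by apply: le_trans h2; rewrite distrC.
have [] := @intervals_meet R b c n2%:~R n3%:~R r b0 c0.
  by apply: le_trans h1.
have lh x (v : int) : 0 < v -> (x + 1 / 2 - r) / v%:~R <= (x + 1 / 2 + r) / v%:~R.
  by move=> v0; rewrite ler_pM2r ?invr_gt0 ?ltr0z //; lra.
have := lh n1%:~R a a0; have := lh n2%:~R b b0; have := lh n3%:~R c c0.
set A := (n1%:~R + 1 / 2 - r) / _; set B := (n2%:~R + 1 / 2 - r) / _.
set C := (n3%:~R + 1 / 2 - r) / _; set A' := (n1%:~R + 1 / 2 + r) / _.
set B' := (n2%:~R + 1 / 2 + r) / _; set C' := (n3%:~R + 1 / 2 + r) / _.
move=> cc bb aa bc cb ac ca ab ba.
(* The largest left endpoint lies in all three intervals, since no left endpoint exceeds a right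
   one. *)
pose t := Num.max A (Num.max B C).
have nh (v n : int) : 0 < v -> (n%:~R + 1 / 2 - r) / v%:~R <= t ->
    t <= (n%:~R + 1 / 2 + r) / v%:~R -> near_half _ t v r.
  move=> v0; rewrite ler_pdivrMr ?ltr0z // ler_pdivlMr ?ltr0z // => k1 k2.
  by exists n; rewrite ler_norml; apply/andP; split; lra.
exists t; split.
- by apply: (nh _ n1) => //;
  rewrite /t ?le_max ?ge_max -/A -/B -/C -/A' -/B' -/C' ?lexx ?aa ?ba ?ca ?orbT.
- by apply: (nh _ n2) => //;
  rewrite /t ?le_max ?ge_max -/A -/B -/C -/A' -/B' -/C' ?lexx ?bb ?ab ?cb ?orbT.
- by apply: (nh _ n3) => //;
  rewrite /t ?le_max ?ge_max -/A -/B -/C -/A' -/B' -/C' ?lexx ?bc ?ac ?cc ?orbT.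
Qed.

(** With [r] the largest of the three ratios, Helly gives a time within [r/2], and [r] is one of the
    ratios. *)
Lemma gap_le_odd_cross (R : realFieldType) (a b c w1 w2 w3 : int) (mu : R) :
  0 < a -> 0 < b -> 0 < c -> gap _ a b c mu -> odd_cross a b c w1 w2 w3 ->
  [\/ 2 * mu * (b + c)%:~R <= `|w1|%:~R, 2 * mu * (a + c)%:~R <= `|w2|%:~R
    | 2 * mu * (a + b)%:~R <= `|w3|%:~R].
Proof.
move=> a0 b0 c0 [_ H] ow.
have bc0 : 0 < (b + c)%:~R :> R by rewrite ltr0z; lia.
have ac0 : 0 < (a + c)%:~R :> R by rewrite ltr0z; lia.
have ab0 : 0 < (a + b)%:~R :> R by rewrite ltr0z; lia.
pose r1 : R := `|w1|%:~R / (b + c)%:~R; pose r2 : R := `|w2|%:~R / (a + c)%:~R.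
pose r3 : R := `|w3|%:~R / (a + b)%:~R.
pose r := Num.max r1 (Num.max r2 r3).
have r2E : 2 * (r / 2) = r by field.
have [| | |t [h1 h2 h3]] := @odd_cross_near_half R a b c w1 w2 w3 (r / 2) a0 b0 c0 ow;
  rewrite ?r2E -?ler_pdivrMr // ?/r ?le_max ?lexx ?orbT //.
have : 2 * mu <= r by have := H _ _ h1 h2 h3; lra.
by rewrite /r !le_max /r1 /r2 /r3 !ler_pdivlMr // => /or3P.
Qed.

(** Eliminating [t] from two coordinates leaves their deviations, each weighted by the other
    speed. *)
Lemma near_half_odd_cross (R : realFieldType) (a b c : int) (t r : R) :
  0 < a -> 0 < b -> 0 < c -> near_half _ t a r -> near_half _ t b r ->
    near_half _ t c r ->
  exists w1 w2 w3, [/\ odd_cross a b c w1 w2 w3,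
    `|w1|%:~R <= 2 * r * (b + c)%:~R, `|w2|%:~R <= 2 * r * (a + c)%:~R &
    `|w3|%:~R <= 2 * r * (a + b)%:~R].
Proof.
move=> a0 b0 c0 [n1 h1] [n2 h2] [n3 h3].
have a0' : 0 < a%:~R :> R by rewrite ltr0z.
have b0' : 0 < b%:~R :> R by rewrite ltr0z.
have c0' : 0 < c%:~R :> R by rewrite ltr0z.
exists ((2 * n2 + 1) * c - (2 * n3 + 1) * b),
  ((2 * n3 + 1) * a - (2 * n1 + 1) * c),
  ((2 * n1 + 1) * b - (2 * n2 + 1) * a); split; first by exists n1, n2, n3.
all: rewrite !intr_norm !(intrB, intrM, intrD) /=.
all: move: h1 h2 h3; rewrite !ler_norml => /andP[? ?] /andP[? ?] /andP[? ?].
all: apply/andP; split; nra.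
Qed.

Lemma gap_attained (R : realFieldType) (a b c : int) (mu : R) :
  0 < a -> 0 < b -> 0 < c -> gap _ a b c mu ->
  exists w1 w2 w3, [/\ odd_cross a b c w1 w2 w3,
    `|w1|%:~R <= 2 * mu * (b + c)%:~R, `|w2|%:~R <= 2 * mu * (a + c)%:~R &
    `|w3|%:~R <= 2 * mu * (a + b)%:~R].
Proof. by move=> a0 b0 c0 [[t [ha hb hc]] _]; exact: near_half_odd_cross ha hb hc. Qed.

(** Reduces an exact gap to integer inequalities, for use on the two attaining families. *)
Lemma gap_fraction (R : realFieldType) (a b c w1 w2 w3 N p : int) :
  0 < a -> 0 < b -> 0 < c -> 0 < p -> odd_cross a b c w1 w2 w3 ->
  `|w1| * p <= N * (b + c) -> `|w2| * p <= N * (a + c) -> `|w3| * p <= N * (a + b) ->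
  (forall x1 x2 x3, odd_cross a b c x1 x2 x3 ->
    [\/ N * (b + c) <= `|x1| * p,
      N * (a + c) <= `|x2| * p | N * (a + b) <= `|x3| * p]) ->
  gap R a b c (N%:~R / (2 * p%:~R)).
Proof.
move=> a0 b0 c0 p0 ow h1 h2 h3 lb.
have p0' : 0 < p%:~R :> R by rewrite ltr0z.
have two_mu : 2 * (N%:~R / (2 * p%:~R)) = N%:~R / p%:~R :> R by field; rewrite gt_eqF.
split.
  by apply: odd_cross_near_half ow _ _ _ => //; rewrite two_mu mulrAC ler_pdivlMr //
    -!intrM ler_int.
move=> t r ha hb hc; rewrite leNgt; apply/negP => r_lt.
have [x1 [x2 [x3 [ox k1 k2 k3]]]] := near_half_odd_cross _ _ _ _ _ _ a0 b0 c0 ha hb hc.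
have low (x s : int) : 0 < s -> N * s <= `|x| * p -> `|x|%:~R <= 2 * r * s%:~R -> False.
  move=> s0; have s0' : 0 < s%:~R :> R by rewrite ltr0z.
  rewrite -(ler_int R) !intrM -ler_pdivrMr // mulrAC => k l; have := le_trans k l.
  by rewrite ler_pM2r // -two_mu ler_pM2l // leNgt r_lt.
by have [k|k|k] := lb _ _ _ ox;
  [apply: low k k1 | apply: low k k2 | apply: low k k3]; exact: addr_gt0.
Qed.

(** Since [l . v = 0], the integer [m . l] is [-2] times the sum of the deviations from 1/2 weighted
    by [l]; being odd, it is at least 1 in absolute value. *)
Lemma odd_relation_gap (R : realFieldType) (a b c l1 l2 l3 : int) (mu : R) :
  gap _ a b c mu -> l1 * a + l2 * b + l3 * c = 0 ->
  (exists e, l1 + l2 + l3 = 2 * e + 1) ->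
  1 <= 2 * mu * (`|l1| + `|l2| + `|l3|)%:~R.
Proof.
move=> [[t [[n1 h1] [n2 h2] [n3 h3]]] _] lv [e le].
pose m := (2 * n1 + 1) * l1 + (2 * n2 + 1) * l2 + (2 * n3 + 1) * l3.
have m0 : 1 <= `|m|.
  have -> : m = 2 * (n1 * l1 + n2 * l2 + n3 * l3 + e) + 1.
    by transitivity (2 * (n1 * l1 + n2 * l2 + n3 * l3) + (l1 + l2 + l3));
      [rewrite /m | rewrite le]; ring.
  lia.
have mE : m%:~R = - 2 * ((t * a%:~R - 1 / 2 - n1%:~R) * l1%:~R +
    (t * b%:~R - 1 / 2 - n2%:~R) * l2%:~R + (t * c%:~R - 1 / 2 - n3%:~R) * l3%:~R) :> R.
  have := congr1 (fun k : int => k%:~R : R) lv; rewrite /m !(intrD, intrM) /= => lv'.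
  transitivity (- 2 * ((t * a%:~R - 1 / 2 - n1%:~R) * l1%:~R +
    (t * b%:~R - 1 / 2 - n2%:~R) * l2%:~R + (t * c%:~R - 1 / 2 - n3%:~R) * l3%:~R)
    + 2 * t * (l1%:~R * a%:~R + l2%:~R * b%:~R + l3%:~R * c%:~R) : R).
    by field.
  by rewrite lv'; ring.
have : (1 : R) <= `|m|%:~R by rewrite ler1z.
move/le_trans; apply; rewrite intr_norm mE normrM normrN [`|2|]ger0_norm //.
rewrite -mulrA ler_pM2l // !intrD !intr_norm !mulrDr.
apply: le_trans (ler_normD _ _) _; apply: lerD; last by rewrite normrM ler_wpM2r.
by apply: le_trans (ler_normD _ _) _; apply: lerD; rewrite normrM ler_wpM2r.
Qed.

(** The value is [q / (2 p)]; in use, [q] is the absolute value of a coordinate of an odd cross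
    product and [p] the matching pair sum. *)
Definition gap_value (R : realFieldType) (mu : R) : Prop :=
  exists p i q : int, [/\ 0 < p, 0 < i < 5, 2 * i + p = 5 * q
    & mu = 1 / 10 + i%:~R / (5 * p%:~R)].

Lemma odd_cross_parity (a b c w1 w2 w3 : int) : odd_cross a b c w1 w2 w3 ->
  exists e1 e2 e3, [/\ w1 = b + c + 2 * e1, w2 = a + c + 2 * e2 & w3 = a + b + 2 * e3].
Proof.
move=> [n1 [n2 [n3 [-> -> ->]]]].
exists (n2 * c - n3 * b - b), (n3 * a - n1 * c - c), (n1 * b - n2 * a - a).
by split; ring.
Qed.

Lemma five_norm_parity (x s e : int) : x = s + 2 * e -> exists j, 5 * `|x| = s + 2 * j.
Proof.
by move=> ->; case: (leP 0 (s + 2 * e)) => h;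
  [exists (2 * s + 5 * e) | exists (- 3 * s - 5 * e)]; lia.
Qed.

Lemma gap_le_tenth (R : realFieldType) (a b c w1 w2 w3 : int) (mu : R) :
  0 < a -> 0 < b -> 0 < c -> gap _ a b c mu -> odd_cross a b c w1 w2 w3 ->
  5 * `|w1| <= b + c -> 5 * `|w2| <= a + c -> 5 * `|w3| <= a + b -> mu <= 1 / 10.
Proof.
move=> a0 b0 c0 G ow; rewrite -3!(ler_int R) !intrM => h1 h2 h3.
have bc0 : 0 < (b + c)%:~R :> R by rewrite ltr0z; lia.
have ac0 : 0 < (a + c)%:~R :> R by rewrite ltr0z; lia.
have ab0 : 0 < (a + b)%:~R :> R by rewrite ltr0z; lia.
by case: (gap_le_odd_cross _ _ _ _ _ _ _ _ a0 b0 c0 G ow) => h; nra.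
Qed.

(* Parity forces [mu = 1/10 + j/(5s)] with [2j = -s] mod 5 for one of the three
   pair sums [s]; the candidate [w] only has to exclude [j >= 5]. *)
Lemma gap_value_of_candidate (R : realFieldType) (a b c w1 w2 w3 p i : int) (mu : R) :
  0 < a -> 0 < b -> 0 < c -> gap _ a b c mu -> 1 / 10 < mu ->
  odd_cross a b c w1 w2 w3 -> 0 < p ->
  5 * `|w1| * p <= (b + c) * (p + 2 * i) ->
  5 * `|w2| * p <= (a + c) * (p + 2 * i) ->
  5 * `|w3| * p <= (a + b) * (p + 2 * i) ->
  (forall j s q, [\/ s = b + c, s = a + c | s = a + b] -> 5 <= j ->
     2 * j + s = 5 * q -> j * p <= i * s -> False) ->
  gap_value _ mu.
Proof.
move=> a0 b0 c0 G mu10 ow p0 h1 h2 h3 small.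
have bc0 : 0 < (b + c)%:~R :> R by rewrite ltr0z; lia.
have ac0 : 0 < (a + c)%:~R :> R by rewrite ltr0z; lia.
have ab0 : 0 < (a + b)%:~R :> R by rewrite ltr0z; lia.
have p0' : 0 < p%:~R :> R by rewrite ltr0z.
have up : 10 * mu * p%:~R <= p%:~R + 2 * i%:~R.
  move: h1 h2 h3; rewrite -3!(ler_int R) ![(_ * _)%:~R]intrM ![(p + _)%:~R]intrD ![(2 * i)%:~R]intrM => h1 h2 h3.
  case: (gap_le_odd_cross _ _ _ _ _ _ _ _ a0 b0 c0 G ow) => h.
  - by rewrite -(ler_pM2l bc0); nra.
  - by rewrite -(ler_pM2l ac0); nra.
  - by rewrite -(ler_pM2l ab0); nra.
clear ow h1 h2 h3.
have [x1 [x2 [x3 [ox k1 k2 k3]]]] := gap_attained _ _ _ _ _ a0 b0 c0 G.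
have [e1 [e2 [e3 [y1 y2 y3]]]] := odd_cross_parity _ _ _ _ _ _ ox.
(* The minimizing vector obeys three upper bounds, and the lower bound of [gap_le_odd_cross] turns
   one of them into an equality. *)
suff [s [x [e [s0 ss xe xs]]]] : exists s x e : int, [/\ 0 < s,
    [\/ s = b + c, s = a + c | s = a + b], x = s + 2 * e
    & `|x|%:~R = 2 * mu * s%:~R].
  have s0' : 0 < s%:~R :> R by rewrite ltr0z.
  have [j jE] : exists j, 5 * `|x| = s + 2 * j.
    exact: five_norm_parity xe.
  have jE' : 5 * (2 * mu * s%:~R) = s%:~R + 2 * j%:~R.
    by rewrite -xs; have := congr1 (fun k : int => k%:~R : R) jE;
      rewrite /= intrD !intrM.
  have muE : mu = 1 / 10 + j%:~R / (5 * s%:~R).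
    apply: (@mulIf _ (10 * s%:~R)); first by rewrite mulf_neq0 ?pnatr_eq0 ?gt_eqF.
    transitivity (s%:~R + 2 * j%:~R : R); first by rewrite -jE'; ring.
    by field; rewrite gt_eqF.
  have j0 : 0 < j by rewrite -(ltr0z R); nra.
  (* Comparison with the bound [1/10 + i/(5p)] of the candidate. *)
  have jp : j * p <= i * s by rewrite -(ler_int R) !intrM; nra.
  have [j5|j5] := ltP j 5.
    by exists s, j, `|x|; split=> //; [rewrite j0 | rewrite jE addrC].
  by case: (small j s `|x| ss j5) => //; rewrite jE addrC.
case: (gap_le_odd_cross _ _ _ _ _ _ _ _ a0 b0 c0 G ox) => h.
- exists (b + c), x1, e1; split=> //;
  [exact: addr_gt0 | by constructor 1 | by apply/eqP; rewrite eq_le k1].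
- exists (a + c), x2, e2; split=> //;
  [exact: addr_gt0 | by constructor 2 | by apply/eqP; rewrite eq_le k2].
- exists (a + b), x3, e3; split=> //;
  [exact: addr_gt0 | by constructor 3 | by apply/eqP; rewrite eq_le k3].
Qed.

(** * Relations of norm five *)

(* [w] bounds the gap by [1/10 + i/(5p)]; the last clause then rules out that the
   gap is [1/10 + j/(5s)] with [j >= 5]. *)
Definition near_candidate (a b c w1 w2 w3 p i : int) : Prop :=
  [/\ 0 < p, 5 * `|w1| * p <= (b + c) * (p + 2 * i),
     5 * `|w2| * p <= (a + c) * (p + 2 * i),
     5 * `|w3| * p <= (a + b) * (p + 2 * i) &
     forall j s q, [\/ s = b + c, s = a + c | s = a + b] -> 5 <= j ->
       2 * j + s = 5 * q -> j * p <= i * s -> False].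

(** The first alternative keeps the gap at or below 1/10, outside the interval studied. *)
Definition has_candidate (a b c : int) : Prop :=
  exists w1 w2 w3, odd_cross a b c w1 w2 w3 /\
   ([/\ 5 * `|w1| <= b + c, 5 * `|w2| <= a + c & 5 * `|w3| <= a + b] \/
    exists p i, near_candidate a b c w1 w2 w3 p i).

Lemma norm5_le (w p s t x : int) : 5 * w = x -> 0 < p -> x * p <= s * t ->
  - x * p <= s * t ->
  5 * `|w| * p <= s * t.
Proof.
move=> <- p0 h1 h2; case: (leP 0 w) => w0; first by rewrite ger0_norm.
by rewrite ltr0_norm // mulrN.
Qed.

Lemma norm5_le_sum (w p s i : int) : 0 <= p -> 0 <= s -> 0 <= i ->
  5 * `|w| <= s -> 5 * `|w| * p <= s * (p + 2 * i).
Proof.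
move=> p0 s0 i0 ws; have := mulr_ge0 s0 i0.
have : 0 <= (s - 5 * `|w|) * p by apply: mulr_ge0 => //; lia.
lia.
Qed.

(** The estimates below are quadratic; [lia] closes them once the right products are supplied. *)
Ltac nonneg_prod x y :=
  let H := fresh in have H : 0 <= x * y by [apply: mulr_ge0; lia]; move: H.

(** Exchanging two coordinates reverses the orientation of the cross product, hence the signs. *)
Lemma near_candidate_swap23 (a b c w1 w2 w3 p i : int) :
  near_candidate a c b (- w1) (- w3) (- w2) p i -> near_candidate a b c w1 w2 w3 p i.
Proof.
rewrite /near_candidate !normrN => -[p0 h1 h2 h3 h4]; split=> //.
  by rewrite (addrC b).
by move=> j s q ss; apply: h4; case: ss => ->; [constructor 1;
  rewrite addrC | constructor 3 | constructor 2].
Qed.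

Lemma near_candidate_swap12 (a b c w1 w2 w3 p i : int) :
  near_candidate b a c (- w2) (- w1) (- w3) p i -> near_candidate a b c w1 w2 w3 p i.
Proof.
rewrite /near_candidate !normrN => -[p0 h1 h2 h3 h4]; split=> //.
  by rewrite (addrC a).
by move=> j s q ss; apply: h4; case: ss => ->;
  [constructor 2 | constructor 1 | constructor 3; rewrite addrC].
Qed.

(** The second bound is an equality, which fixes [p = a + c]. The condition [i * a <= a + c] serves
    to exclude [j >= 5]: with [b = 3 a - c], both [i (b + c) = 3 i a] and [i (a + b) < 4 i a] stay
    below [5 p]. *)
Lemma family1_candidate (a c w1 w2 w3 i : int) : 0 < a -> 0 < c -> c < 3 * a ->
  12 <= a + c -> 0 < i <= 4 -> i * a <= a + c ->
  5 * w1 = 3 * a - 2 * c + 6 * i -> 5 * w2 = - (a + c) - 2 * i ->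
  5 * w3 = 4 * a - c - 2 * i ->
  near_candidate a (3 * a - c) c w1 w2 w3 (a + c) i.
Proof.
move=> a0 c0 ca big i5 ia e1 e2 e3; split; first by lia.
- apply: norm5_le e1 _ _ _; first lia.
    nonneg_prod c (a + c - 3 * i); lia.
  nonneg_prod (3 * a - c) (a + c); nonneg_prod i a; nonneg_prod i c; lia.
- apply: norm5_le e2 _ _ _; first lia.
    nonneg_prod (a + c) (a + c); nonneg_prod i (a + c); lia.
  lia.
- apply: norm5_le e3 _ _ _; first lia.
    nonneg_prod i (a + c); nonneg_prod i (4 * a - c); lia.
  nonneg_prod (a + c) (4 * a - c - i); nonneg_prod i (4 * a - c); lia.
move=> j s q ss j5 _; nonneg_prod (j - 5) (a + c); nonneg_prod (4 - i) (a + c).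
nonneg_prod (i - 1) (a + c); case: ss => ->; lia.
Qed.

Lemma family1 (a b c : int) : 0 < a -> 0 < b -> 0 < c -> bezout3 a b c ->
  300 <= a + b + c -> 3 * a = b + c -> has_candidate a b c.
Proof.
move=> a0 b0 c0 uv big eqv.
have lv : 3 * a + (-1) * b + (-1) * c = 0 by lia.
have [|||||w1 [w2 [w3 [k [ow kb e1 e2 e3]]]]] :=
  @odd_cross_on_line a b c 3 (-1) (-1) 1 (-1) (-1) 1 5 uv => //.
- by exists 0, 0, (-1).
- by exists 0.
have [p1 [p2 [p3 [y1 y2 y3]]]] := odd_cross_parity _ _ _ _ _ _ ow.
(* The parity of [w2] makes [k] even, so [|k| <= 5] leaves [|i| <= 2]. *)
have [i kE] : exists i, k = 2 * i by exists (- 3 * (a + c) - 5 * p2); lia.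
have bE : b = 3 * a - c by lia.
have cE : c = 3 * a - b by lia.
have pos i' x1 x2 x3 : odd_cross a b c x1 x2 x3 -> 0 < i' <= 4 -> i' * a <= a + c ->
  5 * x1 = b - c + 6 * i' -> 5 * x2 = - (a + c) - 2 * i' -> 5 * x3 = a + b - 2 * i' ->
  has_candidate a b c.
  move=> ox i5 ia f1 f2 f3; exists x1, x2, x3; split=> //; right; exists (a + c), i'.
  by rewrite bE; apply: family1_candidate => //; lia.
have neg i' x1 x2 x3 : odd_cross a b c x1 x2 x3 -> 0 < i' <= 4 -> i' * a <= a + b ->
  5 * x1 = b - c - 6 * i' -> 5 * x2 = - (a + c) + 2 * i' -> 5 * x3 = a + b + 2 * i' ->
  has_candidate a b c.
  move=> ox i5 ia f1 f2 f3; exists x1, x2, x3; split=> //; right; exists (a + b), i'.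
  by rewrite [in near_candidate _ _ c]cE; apply: near_candidate_swap23;
    apply: family1_candidate => //; lia.
(* [pos] and [neg] mirror each other under exchange of [b] and [c]. If the size condition fails on
   one side, the neighbouring point, with [5 - |i|] for [|i|], satisfies it on the other. *)
have [i0|i0|i0] := ltgtP i 0.
- have [ia|ia] := leP (- i * a) (a + b); first by apply: (neg (- i) w1 w2 w3) => //;
  lia.
  by apply: (pos (5 + i) _ _ _ (odd_cross_shift _ _ _ _ _ _ _ _ _ 1 uv lv ow)); lia.
- have [ia|ia] := leP (i * a) (a + c); first by apply: (pos i w1 w2 w3) => //; lia.
  by apply: (neg (5 - i) _ _ _ (odd_cross_shift _ _ _ _ _ _ _ _ _ (-1) uv lv ow)); lia.
- exists w1, w2, w3; split=> //; left; split; lia.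
Qed.

Lemma family2_candidate_pos (a b w1 w2 w3 : int) : 0 < a -> 0 < b -> 10 <= a + b ->
  5 * w1 = 3 * a + 2 * b + 6 -> 5 * w2 = - (4 * a + b) + 2 -> 5 * w3 = b - a - 2 ->
  near_candidate a b (3 * a + b) w1 w2 w3 (3 * a + 2 * b) 3.
Proof.
move=> a0 b0 big e1 e2 e3; split; first by lia.
- by apply: norm5_le e1 _ _ _; nonneg_prod a a; nonneg_prod a b; nonneg_prod b b; lia.
- by apply: norm5_le e2 _ _ _; nonneg_prod a a; nonneg_prod a b; nonneg_prod b b; lia.
- apply: norm5_le e3 _ _ _; first lia.
    nonneg_prod a a; nonneg_prod a b; nonneg_prod b b; lia.
  nonneg_prod (b - 1) (3 * a + 2 * b); nonneg_prod a a; nonneg_prod a b; lia.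
by move=> j s q ss j5 _; nonneg_prod (j - 5) (3 * a + 2 * b); case: ss => ->; lia.
Qed.

Lemma family2_candidate_neg (a b w1 w2 w3 i : int) : 0 < a -> 0 < b -> 10 <= a + b ->
  0 < i <= 3 ->
  5 * w1 = 3 * a + 2 * b - 6 * i -> 5 * w2 = - (4 * a + b) - 2 * i ->
  5 * w3 = b - a + 2 * i ->
  near_candidate a b (3 * a + b) w1 w2 w3 (4 * a + b) i.
Proof.
move=> a0 b0 big i3 e1 e2 e3; split; first by lia.
- apply: norm5_le e1 _ _ _; first lia.
    nonneg_prod i a; nonneg_prod i b; lia.
  nonneg_prod (3 * a + 2 * b - 3 * i) (4 * a + b); nonneg_prod i a; nonneg_prod i b;
    lia.
- apply: norm5_le e2 _ _ _; first lia.
    nonneg_prod (4 * a + b) (4 * a + b); nonneg_prod i a; nonneg_prod i b; lia.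
  lia.
- apply: norm5_le e3 _ _ _; first lia.
    nonneg_prod a (4 * a + b - 3 * i); nonneg_prod i a; lia.
  nonneg_prod b (4 * a + b); nonneg_prod i a; nonneg_prod i b; lia.
move=> j s q ss j5 jq; have [i2|i2] := ltP i 3.
  nonneg_prod (j - 5) (4 * a + b); nonneg_prod (2 - i) a; nonneg_prod (2 - i) b.
  by case: ss => ->; lia.
have {i2 i3}iE : i = 3 by lia.
subst i; case: ss => sE; subst s.
(* Size alone allows [j = 5] when [b] is large; but [5 w1 = s - 18], so [s] is not divisible by 5
   and [j = 5] is impossible. *)
- have j6 : 6 <= j by lia.
  by nonneg_prod (j - 6) (4 * a + b); lia.
- by nonneg_prod (j - 5) (4 * a + b); lia.
- by nonneg_prod (j - 5) (4 * a + b); lia.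
Qed.

Lemma family2 (a b c : int) : 0 < a -> 0 < b -> bezout3 a b c ->
  300 <= a + b + c -> 3 * a + b = c -> has_candidate a b c.
Proof.
move=> a0 b0 uv big cE.
have lv : 3 * a + 1 * b + (-1) * c = 0 by lia.
have [|||||w1 [w2 [w3 [k [ow kb e1 e2 e3]]]]] :=
  @odd_cross_on_line a b c 3 1 (-1) 1 1 (-1) 1 5 uv => //.
- by exists 0, 0, (-1).
- by exists (-1).
have [p1 [p2 [p3 [y1 y2 y3]]]] := odd_cross_parity _ _ _ _ _ _ ow.
have [i kE] : exists i, k = 2 * i by exists (3 * (a + c) + 5 * p2); lia.
have ow' := odd_cross_shift _ _ _ _ _ _ _ _ _ (-1) uv lv ow.
have {kb} [i0|[i1|[i2|[i1|i2]]]] : i = 0 \/ i = 1 \/ i = 2 \/ i = -1 \/ i = -2 by lia.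
- by exists w1, w2, w3; split=> //; left; split; lia.
- exists w1, w2, w3; split=> //; right; exists (3 * a + 2 * b), 3.
  by rewrite -cE; apply: family2_candidate_pos; lia.
(* At [i = 2] the coefficient 3 would give the first coordinate excess 6; the neighbour [k = 4 - 10]
   has excess 3 in the second. *)
- exists (w1 + 2 * (-1) * 3), (w2 + 2 * (-1) * 1), (w3 + 2 * (-1) * (-1)).
  split=> //; right; exists (4 * a + b), 3.
  by rewrite -cE; apply: family2_candidate_neg; lia.
- exists w1, w2, w3; split=> //; right; exists (4 * a + b), 1.
  by rewrite -cE; apply: family2_candidate_neg; lia.
- exists w1, w2, w3; split=> //; right; exists (4 * a + b), 2.
  by rewrite -cE; apply: family2_candidate_neg; lia.
Qed.

Lemma family3_candidate (a b w1 w2 w3 i : int) : 0 < a -> 0 < b -> 10 <= a + b ->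
  0 < i <= 2 ->
  5 * w1 = 2 * a + 3 * b + 4 * i -> 5 * w2 = - (3 * a + 2 * b) + 4 * i ->
  5 * w3 = b - a - 2 * i ->
  near_candidate a b (2 * a + 2 * b) w1 w2 w3 (2 * a + 3 * b) (2 * i).
Proof.
move=> a0 b0 big i2 e1 e2 e3; split; first by lia.
- apply: norm5_le e1 _ _ _; first lia.
    lia.
  nonneg_prod (2 * a + 3 * b) (2 * a + 3 * b); nonneg_prod i a; nonneg_prod i b; lia.
- apply: norm5_le e2 _ _ _; first lia.
    nonneg_prod (3 * a + 2 * b - 2 * i) (2 * a + 3 * b); nonneg_prod i a;
      nonneg_prod i b; lia.
  nonneg_prod i a; nonneg_prod i b; lia.
- apply: norm5_le e3 _ _ _; first lia.
    nonneg_prod a (2 * a + 3 * b); nonneg_prod i a; nonneg_prod i b; lia.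
  nonneg_prod b (2 * a + 3 * b - i); nonneg_prod i a; nonneg_prod i b; lia.
move=> j s q ss j5 jq; have [i1|i1] := ltP i 2.
  have iE : i = 1 by lia.
  by subst i; nonneg_prod (j - 5) (2 * a + 3 * b); case: ss => ->; lia.
have {i1 i2}iE : i = 2 by lia.
subst i; case: ss => sE; subst s.
- by nonneg_prod (j - 5) (2 * a + 3 * b); lia.
- have j6 : 6 <= j by lia.
  by nonneg_prod (j - 6) (2 * a + 3 * b); lia.
- by nonneg_prod (j - 5) (2 * a + 3 * b); lia.
Qed.

Lemma family3 (a b c : int) : 0 < a -> 0 < b -> bezout3 a b c ->
  300 <= a + b + c -> 2 * a + 2 * b = c -> has_candidate a b c.
Proof.
move=> a0 b0 uv big cE.
have lv : 2 * a + 2 * b + (-1) * c = 0 by lia.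
have [|||||w1 [w2 [w3 [k [ow kb e1 e2 e3]]]]] :=
  @odd_cross_on_line a b c 2 2 (-1) 1 1 (-1) 1 5 uv => //.
- by exists 0, 0, (-1).
- by exists (-1).
have [p1 [p2 [p3 [y1 y2 y3]]]] := odd_cross_parity _ _ _ _ _ _ ow.
have [i kE] : exists i, k = 2 * i by exists (- 3 * a - 2 * b - 5 * p3); lia.
have [i0|[i1|i1]] : i = 0 \/ 0 < i <= 2 \/ 0 < - i <= 2 by lia.
- by exists w1, w2, w3; split=> //; left; split; lia.
- exists w1, w2, w3; split=> //; right; exists (2 * a + 3 * b), (2 * i).
  by rewrite -cE; apply: family3_candidate; lia.
- exists w1, w2, w3; split=> //; right; exists (2 * b + 3 * a), (2 * - i).
  rewrite -cE (addrC (2 * a)); apply: near_candidate_swap12.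
  by apply: family3_candidate; lia.
Qed.

Lemma family4_candidate_pos (a c w1 w2 w3 i : int) : 0 < a -> 0 < c -> 10 <= a + c ->
  0 < i <= 2 ->
  5 * w1 = - (a + 3 * c) + 4 * i -> 5 * w2 = a - 2 * c - 4 * i ->
  5 * w3 = 2 * a + c + 2 * i ->
  near_candidate a (a + c) (2 * c) w1 w2 w3 (2 * a + c) i.
Proof.
move=> a0 c0 big i2 e1 e2 e3; split; first by lia.
- apply: norm5_le e1 _ _ _; first lia.
    nonneg_prod (a + 3 * c - 2 * i) (2 * a + c); nonneg_prod i a; nonneg_prod i c; lia.
  nonneg_prod i a; nonneg_prod i c; lia.
- apply: norm5_le e2 _ _ _; first lia.
    nonneg_prod c (2 * a + c); nonneg_prod i a; nonneg_prod i c; lia.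
  nonneg_prod a (2 * a + c - 3 * i); nonneg_prod i a; nonneg_prod i c; lia.
- apply: norm5_le e3 _ _ _; first lia.
    lia.
  nonneg_prod (2 * a + c) (2 * a + c); nonneg_prod i a; nonneg_prod i c; lia.
move=> j s q ss j5 jq; have [i1|i1] := ltP i 2.
  have iE : i = 1 by lia.
  by subst i; nonneg_prod (j - 5) (2 * a + c); case: ss => ->; lia.
have {i1 i2}iE : i = 2 by lia.
subst i; case: ss => sE; subst s.
- have j6 : 6 <= j by lia.
  by nonneg_prod (j - 6) (2 * a + c); lia.
- by nonneg_prod (j - 5) (2 * a + c); lia.
- by nonneg_prod (j - 5) (2 * a + c); lia.
Qed.

Lemma family4_candidate_neg (a c w1 w2 w3 i : int) : 0 < a -> 0 < c -> 10 <= a + c ->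
  0 < i <= 2 ->
  5 * w1 = - (a + 3 * c) - 4 * i -> 5 * w2 = a - 2 * c + 4 * i ->
  5 * w3 = 2 * a + c - 2 * i ->
  near_candidate a (a + c) (2 * c) w1 w2 w3 (a + 3 * c) (2 * i).
Proof.
move=> a0 c0 big i2 e1 e2 e3; split; first by lia.
- apply: norm5_le e1 _ _ _; first lia.
    nonneg_prod (a + 3 * c) (a + 3 * c); nonneg_prod i a; nonneg_prod i c; lia.
  lia.
- apply: norm5_le e2 _ _ _; first lia.
    nonneg_prod c (a + 3 * c - i); nonneg_prod i a; nonneg_prod i c; lia.
  nonneg_prod a (a + 3 * c); nonneg_prod i a; nonneg_prod i c; lia.
- apply: norm5_le e3 _ _ _; first lia.
    nonneg_prod i a; nonneg_prod i c; lia.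
  nonneg_prod (2 * a + c - i) (a + 3 * c); nonneg_prod i a; nonneg_prod i c; lia.
move=> j s q ss j5 jq; have [i1|i1] := ltP i 2.
  have iE : i = 1 by lia.
  by subst i; nonneg_prod (j - 5) (a + 3 * c); case: ss => ->; lia.
have {i1 i2}iE : i = 2 by lia.
subst i; case: ss => sE; subst s.
- by nonneg_prod (j - 5) (a + 3 * c); lia.
- by nonneg_prod (j - 5) (a + 3 * c); lia.
(* From [5 w3 = s - 4] and [2 j + s = 5 q] follows [j = 3] modulo 5. *)
- have j8 : 8 <= j by lia.
  by nonneg_prod (j - 8) (a + 3 * c); lia.
Qed.

Lemma family4 (a b c : int) : 0 < a -> 0 < c -> bezout3 a b c ->
  300 <= a + b + c -> 2 * b = 2 * a + c -> has_candidate a b c.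
Proof.
move=> a0 c0 uv big eqv.
have lv : 2 * a + (-2) * b + 1 * c = 0 by lia.
have [|||||w1 [w2 [w3 [k [ow kb e1 e2 e3]]]]] :=
  @odd_cross_on_line a b c 2 (-2) 1 1 (-1) 1 1 5 uv => //.
- by exists 0, 0, 1.
- by exists 0.
have [p1 [p2 [p3 [y1 y2 y3]]]] := odd_cross_parity _ _ _ _ _ _ ow.
have [i kE] : exists i, k = 2 * i by exists (2 * (a + b) + 5 * p3); lia.
have [c' [cE bE]] : exists c', c = 2 * c' /\ b = a + c' by exists (b - a); lia.
have [i0|[i1|i1]] : i = 0 \/ 0 < i <= 2 \/ 0 < - i <= 2 by lia.
- by exists w1, w2, w3; split=> //; left; split; lia.
- exists w1, w2, w3; split=> //; right; exists (2 * a + c'), i.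
  by rewrite cE bE; apply: family4_candidate_pos; lia.
- exists w1, w2, w3; split=> //; right; exists (a + 3 * c'), (2 * - i).
  by rewrite cE bE; apply: family4_candidate_neg; lia.
Qed.

(** The relation leaves out [c], and [w3 = a] is exactly a fifth of [a + b]. The point suffices when
    [|k| <= a]; otherwise [a <= 4] because [|k| <= 5], and [c] is the large coordinate. *)
Lemma family5 (a b c : int) : 0 < a -> 0 < c -> bezout3 a b c ->
  300 <= a + b + c -> b = 4 * a -> has_candidate a b c.
Proof.
move=> a0 c0 uv big eqv.
have lv : 4 * a + (-1) * b + 0 * c = 0 by lia.
have [|||||w1 [w2 [w3 [k [ow kb e1 e2 e3]]]]] :=
  @odd_cross_on_line a b c 4 (-1) 0 1 (-1) 0 1 5 uv => //.
- by exists 0, (-1), 0.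
- by exists (-1).
have [p1 [p2 [p3 [y1 y2 y3]]]] := odd_cross_parity _ _ _ _ _ _ ow.
have [i kE] : exists i, k = a + 2 * i by exists (- 3 * a - 3 * c - 5 * p2); lia.
have [ka|ka] := leP `|k| a.
  by exists w1, w2, w3; split=> //; left; split; lia.
have cand i' x1 x2 x3 : odd_cross a b c x1 x2 x3 -> 0 < i' <= 3 ->
    5 * x1 = - c + 4 * (a + 2 * i') -> 5 * x2 = - (a + c) - 2 * i' -> x3 = a ->
    has_candidate a b c.
  move=> ox i3 f1 f2 f3; exists x1, x2, x3; split=> //; right; exists (a + c), i'.
  split; first by lia.
  - by apply: norm5_le_sum; lia.
  - apply: norm5_le f2 _ _ _; first lia.
      nonneg_prod (a + c) (a + c); nonneg_prod i' (a + c); lia.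
    lia.
  - by apply: norm5_le_sum; lia.
  move=> j s q ss j5 _; nonneg_prod (j - 5) (a + c).
  have : i' = 1 \/ i' = 2 \/ i' = 3 by lia.
  by case=> [->|[->|->]]; case: ss => ->; lia.
have [i0|i0] := ltP 0 i; first by apply: (cand i w1 w2 w3) => //; lia.
by apply: (cand (5 + i) _ _ _ (odd_cross_shift _ _ _ _ _ _ _ _ _ 1 uv lv ow)); lia.
Qed.

(** As for [b = 4 a], now with [w3 = d] for [a = 2 d], [b = 3 d]; the exceptional case is [|k| > d],
    hence [d <= 4]. *)
Lemma family6 (a b c : int) : 0 < a -> 0 < c -> bezout3 a b c ->
  300 <= a + b + c -> 3 * a = 2 * b -> has_candidate a b c.
Proof.
move=> a0 c0 uv big eqv.
have lv : 3 * a + (-2) * b + 0 * c = 0 by lia.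
have [|||||w1 [w2 [w3 [k [ow kb e1 e2 e3]]]]] :=
  @odd_cross_on_line a b c 3 (-2) 0 1 (-1) 0 1 5 uv => //.
- by exists 1, 1, 0.
- by exists 0.
have [p1 [p2 [p3 [y1 y2 y3]]]] := odd_cross_parity _ _ _ _ _ _ ow.
have [d [aE bE]] : exists d, a = 2 * d /\ b = 3 * d by exists (b - a); lia.
have [i kE] : exists i, k = d + 2 * i by exists (7 * d + 3 * c + 5 * p1 - k); lia.
have [ka|ka] := leP `|k| d.
  by exists w1, w2, w3; split=> //; left; split; lia.
have cand k' x1 x2 x3 : odd_cross a b c x1 x2 x3 -> 0 < k' - d <= 4 -> k' <= 5 ->
    5 * x1 = - c + 3 * k' -> 5 * x2 = - c - 2 * k' -> x3 = d ->
    has_candidate a b c.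
  move=> ox i3 k5 f1 f2 f3; exists x1, x2, x3; split=> //; right;
    exists (a + c), (k' - d).
  split; first by lia.
  - by apply: norm5_le_sum; lia.
  - apply: norm5_le f2 _ _ _; first lia.
      nonneg_prod (a + c) (a + c); nonneg_prod (k' - d) (a + c); lia.
    by rewrite aE; lia.
  - by apply: norm5_le_sum; lia.
  move=> j s q ss j5 _; nonneg_prod (j - 5) (a + c).
  set i' := k' - d in i3 *.
  have : i' = 1 \/ i' = 2 \/ i' = 3 \/ i' = 4 by lia.
  by case=> [->|[->|[->|->]]]; case: ss => ->; lia.
have [i0|i0] := ltP 0 i; first by apply: (cand k w1 w2 w3) => //; lia.
(* For [d = 1] the point [k = -5] itself would have excess 6; its neighbour [k = 5] has excess
   [5 - d <= 4]. *)
have [k5|k5] := eqVneq k (-5).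
  by apply: (cand 5 _ _ _ (odd_cross_shift _ _ _ _ _ _ _ _ _ 1 uv lv ow)); lia.
(* What remains is [k = -3], [d = 1] or [k = -4], [d = 2], that is [k = - d - 2]. *)
exists w1, w2, w3; split=> //; right; exists (b + c), 3.
have f1 : 5 * w1 = - (b + c) - 6 by lia.
split; first by lia.
- apply: norm5_le f1 _ _ _; first lia.
    nonneg_prod (b + c) (b + c); lia.
  lia.
- by apply: norm5_le_sum; lia.
- by apply: norm5_le_sum; lia.
by move=> j s q ss j5 _; nonneg_prod (j - 5) (b + c); case: ss => ->; lia.
Qed.

(** * Lines with a large coordinate *)

Lemma bezout3C12 (a b c : int) : bezout3 a b c -> bezout3 b a c.
Proof. by move=> [u1 [u2 [u3 uv]]]; exists u2, u1, u3; rewrite -[RHS]uv; ring. Qed.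

Lemma bezout3C23 (a b c : int) : bezout3 a b c -> bezout3 a c b.
Proof. by move=> [u1 [u2 [u3 uv]]]; exists u1, u3, u2; rewrite -[RHS]uv; ring. Qed.

Lemma has_candidateC12 (a b c : int) : has_candidate b a c -> has_candidate a b c.
Proof.
move=> [w1 [w2 [w3 [[n1 [n2 [n3 [e1 e2 e3]]]] H]]]].
exists (- w2), (- w1), (- w3); split.
  by exists n2, n1, n3; rewrite e1 e2 e3; split; ring.
case: H => [[h1 h2 h3]|[p [i H]]]; [left|right].
  by rewrite !normrN; split=> //; rewrite addrC.
by exists p, i; apply: near_candidate_swap12; rewrite !opprK.
Qed.

Lemma has_candidateC23 (a b c : int) : has_candidate a c b -> has_candidate a b c.
Proof.
move=> [w1 [w2 [w3 [[n1 [n2 [n3 [e1 e2 e3]]]] H]]]].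
exists (- w1), (- w3), (- w2); split.
  by exists n1, n3, n2; rewrite e1 e2 e3; split; ring.
case: H => [[h1 h2 h3]|[p [i H]]]; [left|right].
  by rewrite !normrN; split=> //; rewrite addrC.
by exists p, i; apply: near_candidate_swap23; rewrite !opprK.
Qed.

(** Positivity of [v] discards the relations whose coefficients have a single sign, [(5, 0, 0)]
    among them. *)
Lemma sorted_relation5_candidate (a b c l1 l2 l3 : int) : 0 < a -> 0 < b -> 0 < c ->
  bezout3 a b c -> 300 <= a + b + c -> l1 * a + l2 * b + l3 * c = 0 ->
  `|l1| + `|l2| + `|l3| = 5 -> `|l3| <= `|l2| <= `|l1| -> has_candidate a b c.
Proof.
move=> a0 b0 c0 uv big; wlog l1_gt0 : l1 l2 l3 / 0 < l1 => [wl lv L5 ord|].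
  have [l10|l10] := ltP 0 l1; first exact: (wl l1 l2 l3).
  apply: (wl (- l1) (- l2) (- l3)); rewrite ?normrN //; first by lia.
  by rewrite !mulNr -!opprD lv oppr0.
move=> lv L5 ord.
have [[l1E l2E l3E]|[[l1E [l2E|l2E] l3E]|[[l1E [l2E|l2E] l3E]|[[l1E [l2E|l2E] [l3E|l3E]]|[l1E [l2E|l2E] [l3E|l3E]]]]]] :
  [/\ l1 = 5, l2 = 0 & l3 = 0] \/ [/\ l1 = 4, l2 = 1 \/ l2 = -1 & l3 = 0] \/
  [/\ l1 = 3, l2 = 2 \/ l2 = -2 & l3 = 0] \/
  [/\ l1 = 3, l2 = 1 \/ l2 = -1 & l3 = 1 \/ l3 = -1] \/
  [/\ l1 = 2, l2 = 2 \/ l2 = -2 & l3 = 1 \/ l3 = -1].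
  have : l1 = 5 \/ l1 = 4 \/ l1 = 3 \/ l1 = 2 by lia.
  case=> [E|[E|[E|E]]]; [left | right; left | | right; right; right; right].
  - by split; lia.
  - by split; lia.
  - right; right; have [l20|l20] := eqVneq l3 0; first by left; split; lia.
    by right; left; split; lia.
  - by split; lia.
all: rewrite {}l1E {}l2E {}l3E in lv.
- by lia.
- by lia.
- by apply: family5 => //; lia.
- by lia.
- by apply: family6 => //; lia.
- by lia.
- by apply: family2 => //; lia.
- by apply: has_candidateC23; apply: family2 => //; [exact: bezout3C23 | lia | lia].
- by apply: family1 => //; lia.
- by lia.
- by apply: family3 => //; lia.
- by apply: family4 => //; lia.
- by apply: has_candidateC12; apply: family4 => //; [exact: bezout3C12 | lia | lia].
Qed.

Lemma relation5_candidate (a b c l1 l2 l3 : int) : 0 < a -> 0 < b -> 0 < c ->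
  bezout3 a b c -> 300 <= a + b + c -> l1 * a + l2 * b + l3 * c = 0 ->
  `|l1| + `|l2| + `|l3| = 5 -> has_candidate a b c.
Proof.
wlog l21 : a b c l1 l2 l3 / `|l2| <= `|l1| => [wl a0 b0 c0 uv big lv L5|].
  have [l21|/ltW l12] := leP `|l2| `|l1|; first exact: (wl a b c l1 l2 l3).
  by apply: has_candidateC12; apply: (wl _ _ _ l2 l1 l3) => //;
    [exact: bezout3C12 | lia..].
wlog l31 : a b c l1 l2 l3 l21 / `|l3| <= `|l1| => [wl a0 b0 c0 uv big lv L5|].
  have [l31|/ltW l13] := leP `|l3| `|l1|; first exact: (wl a b c l1 l2 l3).
  apply: has_candidateC23; apply: has_candidateC12; apply: has_candidateC23.
  apply: (wl _ _ _ l3 l2 l1) => //; [lia.. | | lia | lia | lia].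
  by apply: bezout3C23; apply: bezout3C12; exact: bezout3C23.
move=> a0 b0 c0 uv big lv L5.
have [l32|/ltW l23] := leP `|l3| `|l2|.
  by apply: (sorted_relation5_candidate _ _ _ l1 l2 l3) => //; rewrite l32.
apply: has_candidateC23; apply: (sorted_relation5_candidate _ _ _ l1 l3 l2) => //.
- exact: bezout3C23.
- by lia.
- by lia.
- by lia.
- by rewrite l23.
Qed.

(** Dividing by [L] gives [|w| <= y (b + c) / L + |l|], and [1/7 + 2/35 = 1/5]. *)
Lemma line_coordinate_le (L w y s s' k l b c : int) : 0 < L -> 0 < b -> 0 < c ->
  L * w = y * (s * c - s' * b) + k * l -> `|k| <= L -> `|s| <= 1 -> `|s'| <= 1 ->
  35 * `|l| <= 2 * (b + c) -> y = 0 \/ y = 1 /\ 7 <= L -> 5 * `|w| <= b + c.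
Proof.
move=> L0 b0 c0 E kL s1 s'1 lb yL.
have Lw : L * `|w| = `|y * (s * c - s' * b) + k * l| by rewrite -E normrM gtr0_norm.
have kl : `|k * l| <= L * `|l| by rewrite normrM ler_wpM2r.
have sb : `|s * c - s' * b| <= b + c.
  apply: le_trans (ler_normB _ _) _; rewrite !normrM (gtr0_norm b0) (gtr0_norm c0).
  by rewrite addrC; apply: lerD; rewrite ler_piMl // ltW.
have := ler_normD (y * (s * c - s' * b)) (k * l); rewrite -Lw => Lw'.
rewrite -(ler_pM2l L0).
have h := mulr_ge0 (ltW L0) (_ : 0 <= 2 * (b + c) - 35 * `|l|).
have {}h : 0 <= L * (2 * (b + c) - 35 * `|l|) by apply: h; lia.
have bc : 0 <= L * (b + c) by apply: mulr_ge0; lia.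
case: yL => [y0|[y1 L7]].
  by rewrite y0 mul0r normr0 in Lw'; lia.
have : 0 <= (L - 7) * (b + c) by apply: mulr_ge0; lia.
rewrite y1 mul1r in Lw'; lia.
Qed.

Lemma nat_sqrt (n : nat) : exists q : nat, (q ^ 2 <= n < q.+1 ^ 2)%N.
Proof.
elim: n => [|n [q qn]]; first by exists 0%N.
have [h|h] := ltnP n.+1 (q.+1 ^ 2); [exists q | exists q.+1]; nia.
Qed.

(** The threshold is [324 = 18^2]: it gives [q >= 18], so that [35 q <= 2 q^2 <= 2 c]. *)
Lemma candidate_or_short_relation (a b c : int) : 0 < a -> 0 < b -> 324 <= c ->
  bezout3 a b c ->
  (exists l1 l2 l3 e, [/\ l1 * a + l2 * b + l3 * c = 0, l1 + l2 + l3 = 2 * e + 1 &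
     `|l1| + `|l2| + `|l3| <= 3]) \/ has_candidate a b c.
Proof.
move=> a0 b0 c324 uv.
have c0 : 0 < c by lia.
have [q /andP[qc cq]] := nat_sqrt `|c|%N.
have [|x [y [z [xy xq yq xyz]]]] := dirichlet2 a b _ _ _ cq; first by lia.
rewrite gez0_abs in xyz; last by lia.
have [d [l1 [l2 [l3 [d0 xE yE zE gl]]]]] : exists d x' y' z' : int,
    [/\ 0 < d, x = d * x', y = d * y', z = d * z' & bezout3 x' y' z'].
  by apply: bezout3_factor; rewrite xy.
have lv : l1 * a + l2 * b + l3 * c = 0.
  apply: (@mulfI _ d); first by rewrite gt_eqF.
  by rewrite mulr0 -xyz xE yE zE; ring.
have d1 t : `|t| <= `|d * t| by rewrite normrM ler_peMl // gtr0_norm; lia.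
have {xy}l12 : (l1 != 0) || (l2 != 0).
  by move: xy; rewrite xE yE !mulf_eq0 !negb_or gt_eqF.
have {xq}l1q : `|l1| <= q by rewrite (le_trans (d1 _)) // -xE.
have {yq}l2q : `|l2| <= q by rewrite (le_trans (d1 _)) // -yE.
(* [2/35 = 1/5 - 1/7] is the slack left by a relation of norm at least 7. *)
have qc35 : 35 * q%:Z <= 2 * c.
  have q18 : (18 <= q)%N by nia.
  nia.
(* The pigeonhole bounds only [l1] and [l2]; [l3] is read off from [l3 c = - (l1 a + l2 b)]. *)
have l3b : 35 * `|l3| <= 2 * (a + b).
  rewrite -(ler_pM2r c0).
  have -> : 35 * `|l3| * c = 35 * `|l1 * a + l2 * b|.
    by rewrite -mulrA -{1}(gtr0_norm c0) -normrM -[l3 * c]opprK normrN;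
      congr (_ * `|_|); lia.
  have : `|l1 * a + l2 * b| <= q%:Z * (a + b).
    rewrite mulrDr; apply: le_trans (ler_normD _ _) _; rewrite !normrM.
    by rewrite (gtr0_norm a0) (gtr0_norm b0); apply: lerD; apply: ler_wpM2r => //;
      exact: ltW.
  have : 0 <= (2 * c - 35 * q%:Z) * (a + b) by apply: mulr_ge0; lia.
  lia.
pose L := `|l1| + `|l2| + `|l3|.
have L0 : 0 < L by rewrite /L; lia.
have sL : sgz l1 * l1 + sgz l2 * l2 + sgz l3 * l3 = L.
  have sgE (t : int) : sgz t * t = `|t|.
    by case: (sgzP t); lia.
  by rewrite /L !sgE.
have sg1 (t : int) : `|sgz t| <= 1 by case: (sgzP t).
have near y0 : (exists e, y0 = l1 + l2 + l3 + 2 * e) -> y0 = 0 \/ y0 = 1 /\ 7 <= L ->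
    has_candidate a b c.
  move=> ye yL.
  have [w1 [w2 [w3 [k [ow kL e1 e2 e3]]]]] :=
    odd_cross_on_line _ _ _ _ _ _ _ _ _ _ _ uv gl lv sL L0 ye.
  exists w1, w2, w3; split=> //; left; split.
  - by apply: line_coordinate_le e1 _ _ _ _ _ => //; lia.
  - by rewrite addrC; apply: line_coordinate_le e2 _ _ _ _ _ => //; lia.
  - by apply: line_coordinate_le e3 _ _ _ _ _ => //; lia.
have [e [lE|lE]] : exists e, l1 + l2 + l3 = 2 * e \/ l1 + l2 + l3 = 2 * e + 1.
  exists (divz (l1 + l2 + l3) 2); have := divz_eq (l1 + l2 + l3) 2.
  have := @modz_ge0 (l1 + l2 + l3) 2; have := @ltz_pmod (l1 + l2 + l3) 2; lia.
  by right; apply: (near 0); [exists (- e); lia | left].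
have [L7|L7] := leP 7 L.
  by right; apply: (near 1); [exists (- e); lia | right].
have [L3|L3] := leP L 3; first by left; exists l1, l2, l3, e.
(* The norm has the parity of [l1 + l2 + l3]; odd and strictly between 3 and 7, it is 5. *)
right; apply: (relation5_candidate _ _ _ l1 l2 l3) => //; rewrite /L in L3 L7; lia.
Qed.

(** * The circle and its characters *)

Definition class (R : realType) (x : R) : RmodZ R := (\pi_(RmodZ R) x)%qT.
Arguments class {R}.

Lemma class_is_zmod_morphism (R : realType) : zmod_morphism (@class R).
Proof.
move=> x y; rewrite /class (@Quotient.pi_add R (integers R)).
by congr (_ + _); exact: (@Quotient.pi_opp R (integers R)).
Qed.

HB.instance Definition _ (R : realType) :=
  GRing.isZmodMorphism.Build R (RmodZ R) (@class R) (@class_is_zmod_morphism R).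

Lemma class_surj (R : realType) (x : RmodZ R) : exists y : R, x = class y.
Proof. by exists (repr x); rewrite /class reprK. Qed.

Lemma class_eq (R : realType) (x y : R) : class x = class y <-> exists n :
  int, x = y + n%:~R.
Proof.
rewrite /class eq_RmodZ; split; first by move=> /intrP[n xy]; exists n;
  rewrite -xy addrC subrK.
by move=> [n ->]; rewrite addrAC subrr add0r; exact: intr_int.
Qed.

(** The infimum is a minimum, reached at the rounding [floor (y + 1/2)]. *)
Lemma nearest_int_dist_le (R : realType) (y r : R) :
  nearest_int_dist y <= r <-> exists n : int, `|y - n%:~R| <= r.
Proof.
pose S := [set `|y - k%:~R| | k in [set: int]].
pose n0 := Num.floor (y + 1 / 2).
have lbS : lbound S `|y - n0%:~R|.
  move=> _ [k _ <-]; have := Num.Theory.floor_le (y + 1 / 2).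
  have := floorD1_gt (y + 1 / 2); rewrite -/n0 => h1 h2.
  have [->//|kn] := eqVneq k n0.
  have hn : `|y - n0%:~R| <= 1 / 2.
    by rewrite ler_norml; apply/andP; split; move: h1 h2; rewrite ?intrD ?intr1; lra.
  have : (1 : R) <= `|n0%:~R - k%:~R|.
    by rewrite -intrB -intr_norm ler1z; move: kn; rewrite -subr_eq0; lia.
  have := ler_distD y (n0%:~R) (k%:~R : R); rewrite (distrC _ y); lra.
have infE : nearest_int_dist y = `|y - n0%:~R|.
  apply/eqP; rewrite eq_le; apply/andP; split.
    by apply: ge_inf; [exists `|y - n0%:~R| | exists n0].
  by apply: lb_le_inf => //; exists `|y - n0%:~R|, n0.
rewrite infE; split; first by exists n0.
by move=> [n]; apply: le_trans; apply: lbS; exists n.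
Qed.

Lemma nearest_int_dist_attained (R : realType) (y : R) :
  exists n : int, nearest_int_dist y = `|y - n%:~R|.
Proof.
have [n hn] := (nearest_int_dist_le _ y (nearest_int_dist y)).1 (lexx _).
exists n; apply/eqP; rewrite eq_le hn andbT.
by apply/nearest_int_dist_le; exists n.
Qed.

Lemma tnorm_class (R : realType) (y : R) : tnorm (class y) = nearest_int_dist y.
Proof. exact: tnorm_pi. Qed.

Lemma tnorm_class_le (R : realType) (y : R) : tnorm (class y) <= `|y|.
Proof. by rewrite tnorm_class; apply/nearest_int_dist_le; exists 0; rewrite subr0. Qed.

Lemma tnorm_repr (R : realType) (x : RmodZ R) : exists2 y, x = class y & tnorm x = `|y|.
Proof.
have [y ->] := class_surj _ x; have [n hn] := nearest_int_dist_attained _ y.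
exists (y - n%:~R); last by rewrite tnorm_class.
by apply/class_eq; exists n; rewrite subrK.
Qed.

Lemma tnorm_ge0 (R : realType) (x : RmodZ R) : 0 <= tnorm x.
Proof. by have [y _ ->] := tnorm_repr _ x. Qed.

Lemma tnorm0 (R : realType) : tnorm (0 : RmodZ R) = 0.
Proof.
apply/eqP; rewrite eq_le tnorm_ge0 andbT -(raddf0 (@class R)).
by rewrite (le_trans (tnorm_class_le _ _)) ?normr0.
Qed.

Lemma tnorm_eq0 (R : realType) (x : RmodZ R) : tnorm x = 0 -> x = 0.
Proof.
by have [y -> ->] := tnorm_repr _ x => /eqP; rewrite normr_eq0 => /eqP ->;
  rewrite raddf0.
Qed.

Lemma tnormD (R : realType) (x y : RmodZ R) : tnorm (x + y) <= tnorm x + tnorm y.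
Proof.
have [a -> ->] := tnorm_repr _ x; have [b -> ->] := tnorm_repr _ y.
by rewrite -raddfD (le_trans (tnorm_class_le _ _)) ?ler_normD.
Qed.

Lemma tnormMz (R : realType) (x : RmodZ R) (n : int) :
  tnorm (x *~ n) <= `|n|%:~R * tnorm x.
Proof.
have [a -> ->] := tnorm_repr _ x.
by rewrite -raddfMz (le_trans (tnorm_class_le _ _)) // -mulrzl normrM intr_norm.
Qed.

Lemma tnormN (R : realType) (x : RmodZ R) : tnorm (- x) = tnorm x.
Proof.
have h (y : RmodZ R) : tnorm (- y) <= tnorm y.
  have [a -> ->] := tnorm_repr _ y.
  by rewrite -raddfN (le_trans (tnorm_class_le _ _)) ?normrN.
by apply/eqP; rewrite eq_le h -{1}(opprK x) h.
Qed.

Lemma tnorm_distC (R : realType) (x y : RmodZ R) : tnorm (x - y) = tnorm (y - x).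
Proof. by rewrite -tnormN opprB. Qed.

(** Up to 1/4 doubling does not wrap around: [2 y] is within 1/2 of 0, so no other integer is
    nearer. *)
Lemma tnorm_double (R : realType) (x : RmodZ R) : tnorm x <= 1 / 4 ->
  tnorm (x *+ 2) = 2 * tnorm x.
Proof.
have [y -> ->] := tnorm_repr _ x => y4; rewrite -raddfMn tnorm_class.
apply/eqP; rewrite eq_le; apply/andP; split.
  by apply/nearest_int_dist_le; exists 0;
    rewrite subr0 -[y *+ 2]mulr_natl normrM ger0_norm.
have [n ->] := nearest_int_dist_attained _ (y *+ 2).
have [->|n0] := eqVneq n 0; first by rewrite subr0 -[y *+ 2]mulr_natl normrM ger0_norm.
have : (1 : R) <= `|n%:~R| by rewrite -intr_norm ler1z; move: n0; lia.
have := lerB_dist (n%:~R : R) (y *+ 2);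
  rewrite distrC -[y *+ 2]mulr_natl normrM ger0_norm //; lra.
Qed.

(** The quotient topology is that of the distance [tnorm]: neighbourhoods pull back along [class],
    and balls have open preimages. *)
Lemma nbhs_RmodZ (R : realType) (x : RmodZ R) (A : set (RmodZ R)) :
  nbhs x A <-> exists2 e : R, 0 < e & forall z, tnorm (z - x) < e -> A z.
Proof.
split.
  rewrite nbhsE => -[U [oU Ux] UA]; have [y xE] := class_surj _ x.
  have oU' : open ((@class R) @^-1` U) by [].
  have : nbhs y ((@class R) @^-1` U) by apply: open_nbhs_nbhs; split=> //=; rewrite -xE.
  move=> /nbhs_ballP[e /= e0 He]; exists e => // z;
    have [d zx ->] := tnorm_repr _ (z - x).
  move=> de; apply: UA; have -> : z = class (d + y) by rewrite raddfD /= -zx -xE subrK.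
  by apply: (He (d + y)); rewrite /ball /= opprD addrCA subrr addr0 normrN.
move=> [e e0 He]; rewrite nbhsE; exists [set z | tnorm (z - x) < e] => //.
split; last by rewrite /= subrr tnorm0.
rewrite /open /= /quotient_open; have [y ->] := class_surj _ x.
rewrite openE => z /= zy; apply/nbhs_ballP; exists (e - tnorm (class z - class y)).
  by rewrite /= subr_gt0.
move=> t; rewrite /ball /= => zt; rewrite -/(class t).
have -> : class t - class y = class (t - z) + (class z - class y)
  by rewrite raddfB addrA subrK.
apply: le_lt_trans (tnormD _ _ _) _; have := tnorm_class_le _ (t - z).
by rewrite (distrC t) -/(class z) in zt *; lra.
Qed.

Lemma nbhs_torus (R : realType) (n : nat) (x : torus R n) (A : set (torus R n)) :
  nbhs x A <-> exists2 e : R, 0 < e &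
    forall z : torus R n, (forall k, tnorm (z ord0 k - x ord0 k) < e) -> A z.
Proof.
split.
  move=> [P nP PA].
  have /choice[e He] : forall k : 'I_n, exists e : R, 0 < e /\
      forall z, tnorm (z - x ord0 k) < e -> P ord0 k z.
    by move=> k; have /nbhs_RmodZ[e e0 h] := nP ord0 k; exists e.
  exists (\big[Num.min/1]_k e k).
    by apply: lt_bigmin => // k _; have [] := He k.
  move=> z zx; apply: PA => i j; rewrite (ord1 i); have [_] := He j; apply.
  by apply: lt_le_trans (zx j) _; exact: bigmin_le_cond.
move=> [e e0 He]; exists (fun i j => [set z | tnorm (z - x i j) < e]).
  by move=> i j; apply/nbhs_RmodZ; exists e.
by move=> z hz; apply: He => k; exact: hz.
Qed.

(* The difference of [f] and a linear map agreeing with it at a small [1/N] takes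
   all its values at distance at most 1/4 from 0; doubling shows it vanishes. *)
Lemma circle_character (R : realType) (f : {additive R -> RmodZ R}) (d : R) :
  f 1 = 0 -> 0 < d -> (forall t, `|t| < d -> tnorm (f t) < 1 / 8) ->
  exists n : int, forall t, f t = class (t * n%:~R).
Proof.
move=> f1 d0 small.
have [N N0 Nd] : exists2 N : R, 0 < N & N^-1 < d.
  exists (Num.bound d^-1)%:R.
    by rewrite (le_lt_trans _ (archi_boundP _)) // ?invr_ge0 ltW.
  by rewrite invf_plt ?posrE // ?(archi_boundP _) ?invr_ge0 ?ltW //
    (le_lt_trans _ (archi_boundP _)) // ?invr_ge0 ltW.
have Ni0 : 0 < N^-1 by rewrite invr_gt0.
have [b fb bE] := tnorm_repr _ (f N^-1).
have b8 : `|b| < 1 / 8 by rewrite -bE small // gtr0_norm.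
pose h t := f t - class (t * (N * b)).
have hD x y : h (x + y) = h x + h y.
  by rewrite /h raddfD mulrDl raddfD opprD addrACA.
have hM x (k : int) : h (x *~ k) = h x *~ k.
  by rewrite /h raddfMz mulrzAl raddfMz mulrzBl.
have hN : h N^-1 = 0 by rewrite /h fb mulKf ?gt_eqF // subrr.
have h4 t : tnorm (h t) <= 1 / 4.
  pose k := Num.floor (t * N).
  have tE : t = N^-1 *~ k + (t - N^-1 *~ k) by rewrite addrC subrK.
  have : `|t - N^-1 *~ k| <= N^-1.
    have := Num.Theory.floor_le (t * N); have := floorD1_gt (t * N).
    rewrite -/k intrD => h1 h2.
    have E : t - N^-1 *~ k = (t * N - k%:~R) * N^-1 by rewrite -mulrzr; field;
      rewrite gt_eqF.
    rewrite E normrM (gtr0_norm Ni0) ler_piMl ?(ltW Ni0) // ler_norml; apply/andP;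
      split; lra.
  move: tE; move: (t - N^-1 *~ k) => s -> sN; rewrite hD hM hN mul0rz add0r.
  apply: le_trans (tnormD _ _ _) _; rewrite tnormN.
  have s8 := small s (le_lt_trans sN Nd).
  have : `|s * (N * b)| <= `|b|.
    rewrite mulrA normrM ler_piMl // normrM (gtr0_norm N0).
    by rewrite -ler_pdivlMr // mul1r.
  have := tnorm_class_le _ (s * (N * b)); lra.
have hpow t n : tnorm (h (t *+ (2 ^ n))) = 2 ^+ n * tnorm (h t).
  elim: n => [|n IH]; first by rewrite expn0 mulr1n expr0 mul1r.
  rewrite expnSr mulrnA mulr2n hD -mulr2n tnorm_double; last exact: h4.
  by rewrite IH exprS mulrA.
have h0 t : h t = 0.
  apply: tnorm_eq0; apply/eqP; rewrite eq_le tnorm_ge0 andbT leNgt; apply/negP => t0.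
  pose n := Num.bound (tnorm (h t))^-1.
  have := h4 (t *+ (2 ^ n)); rewrite hpow leNgt => /negP; apply.
  have : (tnorm (h t))^-1 < n%:R by apply: archi_boundP; rewrite invr_ge0 ltW.
  have : (n%:R : R) <= 2 ^+ n by rewrite -natrX ler_nat ltnW // ltn_expl.
  move=> h1 h2; have big : 1 < 2 ^+ n * tnorm (h t).
    by rewrite -ltr_pdivrMr // mul1r; exact: lt_le_trans h2 h1.
  by apply: lt_trans big; rewrite ltr_pdivrMr // mul1r ltr1n.
have [n nE] : exists n : int, N * b = 0 + n%:~R.
  apply/class_eq; have := h0 1; rewrite /h f1 mul1r sub0r raddf0 => /eqP.
  by rewrite oppr_eq0 => /eqP.
exists n => t; have /eqP := h0 t; rewrite subr_eq0 => /eqP ->.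
by rewrite nE add0r.
Qed.

(** * Lines and the spectrum *)

Definition line (R : realType) (n : nat) (v : 'I_n -> int) (t : R) : torus R n :=
  \row_k class (t * (v k)%:~R).

Lemma D_line_le (R : realType) (n : nat) (v : 'I_n.+1 -> int) (t r : R) :
  D (line _ _ v t) <= r <-> forall k, near_half _ t (v k) r.
Proof.
have E k : tnorm (line _ _ v t ord0 k - (\pi_(RmodZ R) (1 / 2))%qT) <= r <->
  near_half _ t (v k) r.
  by rewrite mxE -raddfB tnorm_class nearest_int_dist_le.
rewrite /D; split=> [h k|h].
  by apply/E; apply: le_trans h;
    exact: (le_bigmax_cond _ (fun k =>
    tnorm (line _ _ v t ord0 k - (\pi_(RmodZ R) (1 / 2))%qT))).
apply: bigmax_le => [|k _]; last exact/E.
(* The maximum starts from 0, so [0 <= r] is owed; one coordinate supplies it, whence the nonempty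
   index type. *)
by have [n0 h0] := h ord0; exact: le_trans h0.
Qed.

Lemma near_halfN (R : realFieldType) (t r : R) (v : int) :
  near_half _ t (- v) r <-> near_half _ t v r.
Proof.
have h (u : int) : near_half _ t u r -> near_half _ t (- u) r.
  (* The shift by 1 turns [-1/2] back into [1/2]. *)
  move=> [n h]; exists (- n - 1); rewrite -normrN; apply: le_trans h.
  by rewrite le_eqVlt; apply/orP; left; apply/eqP; congr `| _ |;
    rewrite intrB !intrN; field.
by split=> [/h|/h //]; rewrite opprK.
Qed.

Lemma near_half_norm (R : realFieldType) (t r : R) (v : int) :
  near_half _ t `|v| r <-> near_half _ t v r.
Proof. by have [v0|v0] := leP 0 v; [rewrite ger0_norm | rewrite ltr0_norm //;
  exact: near_halfN]. Qed.

Lemma near_half_scale (R : realFieldType) (t r : R) (d v : int) :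
  near_half _ t (d * v) r <-> near_half _ (t * d%:~R) v r.
Proof. by rewrite /near_half intrM mulrA. Qed.

Lemma forall_ord3 (P : 'I_3 -> Prop) :
  (forall k, P k) <-> [/\ P (@Ordinal 3 0 isT),
    P (@Ordinal 3 1 isT) & P (@Ordinal 3 2 isT)].
Proof.
split=> [h|[h0 h1 h2] [[|[|[|//]]] k3]]; first by split.
- by rewrite (_ : Ordinal k3 = @Ordinal 3 0 isT) //; apply: val_inj.
- by rewrite (_ : Ordinal k3 = @Ordinal 3 1 isT) //; apply: val_inj.
- by rewrite (_ : Ordinal k3 = @Ordinal 3 2 isT) //; apply: val_inj.
Qed.

Definition vec3 (a b c : int) (k : 'I_3) : int := nth 0 [:: a; b; c] k.

Lemma is_D_of_line_gap (R : realType) (a b c : int) (m : R) :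
  is_D_of_set (range (line R 3 (vec3 a b c))) m <-> gap _ a b c m.
Proof.
have near t r : D (line _ _ (vec3 a b c) t) <= r <->
    [/\ near_half _ t a r, near_half _ t b r & near_half _ t c r].
  by rewrite D_line_le forall_ord3.
split=> [[[_ [t _ <-] tm] lb]|[[t /near tm] H]].
  split; first by exists t; apply/near; rewrite tm.
  move=> s r ha hb hc; apply: (@le_trans _ _ (D (line _ _ (vec3 a b c) s))).
    by apply: lb; exists (line _ _ (vec3 a b c) s) => //; exists s.
  exact/near.
have lb s : m <= D (line _ _ (vec3 a b c) s).
  have /near[h1 h2 h3] := lexx (D (line _ _ (vec3 a b c) s)).
  exact: H h1 h2 h3.
split; last by move=> _ [_ [s _ <-] <-].
exists (line _ _ (vec3 a b c) t); first by exists t.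
by apply/eqP; rewrite eq_le tm lb.
Qed.

Lemma gap_norm (R : realFieldType) (a b c : int) (m : R) :
  gap _ a b c m -> gap _ `|a| `|b| `|c| m.
Proof.
move=> [[t [ha hb hc]] H]; split.
  by exists t; split; apply/near_half_norm.
by move=> s r /near_half_norm ka /near_half_norm kb /near_half_norm; exact: H ka kb.
Qed.

Lemma gap_scale (R : realFieldType) (d a b c : int) (m : R) : 0 < d ->
  gap _ (d * a) (d * b) (d * c) m -> gap _ a b c m.
Proof.
move=> d0 [[t [ha hb hc]] H]; split.
  by exists (t * d%:~R); split; apply/near_half_scale.
have dn0 : d%:~R != 0 :> R by rewrite intr_eq0 gt_eqF.
move=> s r ka kb kc; apply: (H (s / d%:~R)); apply/near_half_scale; rewrite divfK //.
Qed.

(** Each coordinate of the parametrization is a continuous character of the circle, hence an integer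
    multiple; properness makes the three integers nonzero. *)
Lemma spectrum_gap (R : realType) (m : R) : spectrum R 1 3 m ->
  exists a b c : int, [/\ 0 < a, 0 < b, 0 < c, bezout3 a b c & gap _ a b c m].
Proof.
move=> [T [[_ Tprop] [phi [psi [cphi rphi _ _]]] DT]].
pose row1 (t : R) : torus R 1 := \row_j class t.
have row1_surj x : exists t, x = row1 t.
  have [t xt] := class_surj _ (x ord0 ord0); exists t.
  by apply/rowP => j; rewrite mxE (ord1 j).
have /choice[v vE] : forall k : 'I_3, exists n : int, forall t : R,
    phi (row1 t) ord0 k = class (t * n%:~R).
  move=> k; pose f t := phi (row1 t) ord0 k.
  have fB : zmod_morphism f.
    move=> x y; rewrite /f (_ : row1 (x - y) = row1 x - row1 y) ?raddfB ?mxE //.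
    by apply/rowP => j; rewrite !mxE raddfB.
  pose F : {additive R -> RmodZ R} := HB.pack f (GRing.isZmodMorphism.Build _ _ f fB).
  have F1 : F 1 = 0.
    rewrite /F /= /f (_ : row1 1 = 0) ?raddf0 ?mxE //.
    by apply/rowP => j; rewrite !mxE -[RHS](raddf0 (@class R)); apply/class_eq;
      exists 1; rewrite add0r.
  have nb : nbhs (phi 0) [set z : torus R 3 | tnorm (z ord0 k) < 1 / 8].
    apply/nbhs_torus; exists (1 / 8) => // z /(_ k).
    by rewrite raddf0 mxE subr0.
  have /nbhs_torus[d d0 dP] := cphi 0 _ nb.
  apply: (circle_character _ F d) => // t td; apply: dP => j.
  by rewrite !mxE subr0 (le_lt_trans (tnorm_class_le _ _)).
have TE : T = range (line R 3 (vec3 (v (@Ordinal 3 0 isT)) (v (@Ordinal 3 1 isT)) (v (@Ordinal 3 2 isT)))).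
  have lE t : phi (row1 t) = line R 3 (vec3 (v (@Ordinal 3 0 isT)) (v (@Ordinal 3 1 isT)) (v (@Ordinal 3 2 isT))) t.
    apply/rowP => k; rewrite vE mxE; congr (class (_ * _%:~R)); move: k.
    by apply/forall_ord3.
  rewrite -rphi; apply/seteqP; split=> [_ [x _ <-]|_ [t _ <-]].
    by have [t ->] := row1_surj x; exists t.
  by exists (row1 t).
move: TE; set a := v _; set b := v _; set c := v _ => TE.
have nz k : vec3 a b c k != 0.
  apply/negP => /eqP vk0; apply: Tprop; rewrite TE => _ [t _ <-].
  by exists k => //=; rewrite mxE vk0 mulr0 raddf0.
move: DT; rewrite TE => /is_D_of_line_gap G.
have a0 : a != 0 := nz (@Ordinal 3 0 isT).
have b0 : b != 0 := nz (@Ordinal 3 1 isT).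
have c0 : c != 0 := nz (@Ordinal 3 2 isT).
(* Signs may be dropped since 1/2 is its own opposite modulo 1, and a common factor only rescales
   [t]. *)
have [|d [x [y [z [d0 xE yE zE uv]]]]] := @bezout3_factor `|a| `|b| `|c|.
  by rewrite normr_eq0 a0.
exists x, y, z; split=> //.
- by rewrite -(pmulr_rgt0 _ d0) -xE normr_gt0.
- by rewrite -(pmulr_rgt0 _ d0) -yE normr_gt0.
- by rewrite -(pmulr_rgt0 _ d0) -zE normr_gt0.
- by apply: (gap_scale _ d) => //; rewrite -xE -yE -zE; exact: gap_norm.
Qed.

(** * Primitive lines as proper one-dimensional subtori *)

Lemma tnorm_sum (R : realType) (n : nat) (F : 'I_n -> RmodZ R) :
  tnorm (\sum_k F k) <= \sum_k tnorm (F k).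
Proof.
elim/big_ind2: _ => [|x r y s xr ys|//]; first by rewrite tnorm0.
by apply: le_trans (tnormD _ _ _) _; apply: lerD.
Qed.

Lemma lipschitz_torus_continuous (R : realType) (n p : nat)
    (g : {additive torus R n -> torus R p}) (C : R) : 0 < C ->
  (forall (x : torus R n) r k, 0 < r -> (forall j, tnorm (x ord0 j) < r) ->
    tnorm (g x ord0 k) < C * r) ->
  continuous g.
Proof.
move=> C0 gC x A /nbhs_torus[e e0 eA]; apply/nbhs_torus; exists (e / C).
  exact: divr_gt0.
move=> z zx; apply: eA => k.
have -> : g z ord0 k - g x ord0 k = g (z - x) ord0 k by rewrite raddfB !mxE.
rewrite -[e](divfK (lt0r_neq0 C0)) mulrC; apply: gC; first exact: divr_gt0.
by move=> j; rewrite !mxE.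
Qed.

Definition line_hom (R : realType) (n : nat) (v : 'I_n ->
  int) (x : torus R 1) : torus R n :=
  \row_k (x ord0 ord0 *~ v k).

Lemma line_hom_is_zmod_morphism (R : realType) (n : nat) (v : 'I_n -> int) :
  zmod_morphism (line_hom R n v).
Proof. by move=> x y; apply/rowP => k; rewrite !mxE mulrzBl. Qed.

HB.instance Definition _ (R : realType) (n : nat) (v : 'I_n -> int) :=
  GRing.isZmodMorphism.Build (torus R 1) (torus R n) (line_hom R n v) (line_hom_is_zmod_morphism R n v).

(** For Bezout coefficients [u] of [v] this is a left inverse of [line_hom], the [psi] that
    [has_dim] asks for. *)
Definition line_coord (R : realType) (n : nat) (u : 'I_n ->
  int) (x : torus R n) : torus R 1 :=
  \row_j \sum_k x ord0 k *~ u k.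

Lemma line_coord_is_zmod_morphism (R : realType) (n : nat) (u : 'I_n -> int) :
  zmod_morphism (line_coord R n u).
Proof.
move=> x y; apply/rowP => j; rewrite !mxE -sumrB; apply: eq_bigr => k _.
by rewrite !mxE mulrzBl.
Qed.

HB.instance Definition _ (R : realType) (n : nat) (u : 'I_n -> int) :=
  GRing.isZmodMorphism.Build (torus R n) (torus R 1) (line_coord R n u) (line_coord_is_zmod_morphism R n u).

(** A Lipschitz constant for both homomorphisms; the added 1 makes it positive and the bounds
    strict. *)
Definition size_bound (R : realType) (n : nat) (v : 'I_n ->
  int) : R := 1 + \sum_k `|v k|%:~R.

Lemma size_bound_gt (R : realType) (n : nat) (v : 'I_n ->
  int) : \sum_k `|v k|%:~R < size_bound R n v.
Proof. by rewrite /size_bound ltrDr. Qed.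

Lemma norm_lt_size_bound (R : realType) (n : nat) (v : 'I_n -> int) (k : 'I_n) :
  `|v k|%:~R < size_bound R n v.
Proof.
apply: le_lt_trans (size_bound_gt _ _ _); rewrite (bigD1 k) //= lerDl.
by apply: sumr_ge0 => i _; rewrite ler0z.
Qed.

Lemma size_bound_gt0 (R : realType) (n : nat) (v : 'I_n -> int) : 0 < size_bound R n v.
Proof. by apply: le_lt_trans (size_bound_gt _ _ _); apply: sumr_ge0 => i _;
  rewrite ler0z. Qed.

Lemma line_hom_lipschitz (R : realType) (n : nat) (v : 'I_n ->
  int) (x : torus R 1) (r : R) k :
  0 < r -> (forall j, tnorm (x ord0 j) < r) ->
    tnorm (line_hom R n v x ord0 k) < size_bound R n v * r.
Proof.
move=> r0 xr; rewrite mxE; apply: le_lt_trans (tnormMz _ _ _) _.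
apply: (@le_lt_trans _ _ (`|v k|%:~R * r)); first by rewrite ler_wpM2l ?ler0z // ltW.
by rewrite ltr_pM2r // norm_lt_size_bound.
Qed.

Lemma line_coord_lipschitz (R : realType) (n : nat) (u : 'I_n ->
  int) (x : torus R n) (r : R) k :
  0 < r -> (forall j, tnorm (x ord0 j) < r) ->
    tnorm (line_coord R n u x ord0 k) < size_bound R n u * r.
Proof.
move=> r0 xr; rewrite mxE; apply: le_lt_trans (tnorm_sum _ _ _) _.
apply: (@le_lt_trans _ _ ((\sum_k `|u k|%:~R) * r));
  last by rewrite ltr_pM2r // size_bound_gt.
rewrite mulr_suml; apply: ler_sum => j _; apply: le_trans (tnormMz _ _ _) _.
by rewrite ler_wpM2l ?ler0z // ltW.
Qed.

Lemma line_hom_continuous (R : realType) (n : nat) (v : 'I_n ->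
  int) : continuous (line_hom R n v).
Proof.
by apply: (lipschitz_torus_continuous _ _ _ _ (size_bound R n v));
  [exact: size_bound_gt0 | exact: line_hom_lipschitz].
Qed.

Lemma line_coord_continuous (R : realType) (n : nat) (u : 'I_n ->
  int) : continuous (line_coord R n u).
Proof.
by apply: (lipschitz_torus_continuous _ _ _ _ (size_bound R n u));
  [exact: size_bound_gt0 | exact: line_coord_lipschitz].
Qed.

Lemma line_homK (R : realType) (n : nat) (u v : 'I_n -> int) : \sum_k v k * u k = 1 ->
  cancel (line_hom R n v) (line_coord R n u).
Proof.
move=> vu x; apply/rowP => j; rewrite mxE (ord1 j).
under eq_bigr do rewrite mxE -mulrzA.
by rewrite -mulrz_sumr vu.
Qed.

Lemma range_line_hom (R : realType) (n : nat) (v : 'I_n -> int) :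
  range (line_hom R n v) = range (line R n v).
Proof.
have E t : line_hom R n v (\row_j class t) = line R n v t.
  by apply/rowP => k; rewrite !mxE -raddfMz mulrzr.
apply/seteqP; split=> [_ [x _ <-]|_ [t _ <-]]; last by exists (\row_j class t).
have [t xt] := class_surj _ (x ord0 ord0); exists t => //.
by rewrite -E; congr line_hom; apply/rowP => j; rewrite mxE (ord1 j).
Qed.

(** The line is the fixed set of the retraction [line_hom] after [line_coord]; this map is
    Lipschitz, so limits of fixed points are fixed. *)
Lemma line_closed (R : realType) (n : nat) (u v : 'I_n -> int) : \sum_k v k * u k = 1 ->
  closed (range (line R n v)).
Proof.
move=> vu; rewrite -range_line_hom; apply/closure_id/seteqP; split;
  first exact: subset_closure.
move=> x xcl; exists (line_coord R n u x) => //.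
set g := fun y => line_hom R n v (line_coord R n u y).
pose C := size_bound R n v * size_bound R n u + 1.
have C0 : 0 < C by rewrite addr_gt0 // mulr_gt0 // size_bound_gt0.
have gC e k : 0 < e -> tnorm (g x ord0 k - x ord0 k) < C * e.
  move=> e0; have [|z [[y _ yz] zx]] :=
    xcl [set z | forall k, tnorm (z ord0 k - x ord0 k) < e].
    by apply/nbhs_torus; exists e.
  have gz : g z = z by rewrite /g -yz line_homK.
  have -> : g x ord0 k - x ord0 k = g (x - z) ord0 k + (z ord0 k - x ord0 k).
    have -> : g (x - z) = g x - z.
      by rewrite -[in RHS]gz /g (raddfB (line_coord R n u)) (raddfB (line_hom R n v)).
    by rewrite !mxE addrA subrK.
  apply: le_lt_trans (tnormD _ _ _) _; rewrite mulrDl mul1r; apply: ltrD;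
    last exact: zx.
  rewrite -mulrA; apply: line_hom_lipschitz;
    first by rewrite mulr_gt0 // size_bound_gt0.
  move=> j; apply: line_coord_lipschitz => // i.
  by rewrite !mxE tnorm_distC.
apply/rowP => k; apply/eqP; rewrite -subr_eq0; apply/eqP; apply: tnorm_eq0.
apply/eqP; rewrite eq_le tnorm_ge0 andbT leNgt; apply/negP => t0.
have := gC (tnorm (g x ord0 k - x ord0 k) / C) k (divr_gt0 t0 C0).
by rewrite mulrC divfK ?ltxx // gt_eqF.
Qed.

Lemma line_continuous (R : realType) (n : nat) (v : 'I_n ->
  int) : continuous (line R n v).
Proof.
move=> t A /nbhs_torus[e e0 eA]; apply/nbhs_ballP; exists (e / size_bound R n v).
  by rewrite /= divr_gt0 // size_bound_gt0.
move=> s; rewrite /ball /= ltr_pdivlMr ?size_bound_gt0 // => st; apply: eA => k.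
rewrite !mxE -raddfB -mulrBl; apply: le_lt_trans (tnorm_class_le _ _) _.
rewrite normrM distrC -intr_norm; apply: le_lt_trans st.
by rewrite ler_wpM2l // ltW // norm_lt_size_bound.
Qed.

Lemma line_connected (R : realType) (n : nat) (v : 'I_n ->
  int) : connected (range (line R n v)).
Proof.
apply: connected_continuous_connected.
  by apply/connected_intervalP.
by apply: continuous_subspaceT; exact: line_continuous.
Qed.

(** At time [1 / size_bound] every coordinate [t v_k] is nonzero and smaller than 1 in absolute
    value, so one point avoids all hyperplanes. *)
Lemma line_proper (R : realType) (n : nat) (v : 'I_n -> int) : (forall k, v k != 0) ->
  ~ (range (line R n v) `<=` \bigcup_(i in [set: 'I_n]) [set x | x ord0 i = 0]).
Proof.
move=> v0 /(_ (line R n v (size_bound R n v)^-1)) [];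
  first by exists (size_bound R n v)^-1.
move=> k _ /=; rewrite mxE -[RHS](raddf0 (@class R)) => /class_eq[m].
rewrite add0r => h; have := norm_lt_size_bound R n v k.
have E : (v k)%:~R = m%:~R * size_bound R n v by rewrite -h mulrAC mulVf ?mul1r //
  gt_eqF ?size_bound_gt0.
rewrite intr_norm E normrM (gtr0_norm (size_bound_gt0 R n v)) gtr_pMl ?size_bound_gt0 //.
rewrite -intr_norm ltrz1.
have m0 : m != 0.
  by apply: contra (v0 k) => /eqP m0; rewrite -(intr_eq0 R) E m0 mul0r.
move: m0; clear; lia.
Qed.

Lemma gap_spectrum (R : realType) (a b c : int) (m : R) :
  a != 0 -> b != 0 -> c != 0 -> bezout3 a b c -> gap _ a b c m -> spectrum R 1 3 m.
Proof.
move=> a0 b0 c0 [u1 [u2 [u3 uv]]] G.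
have vu : \sum_k vec3 a b c k * vec3 u1 u2 u3 k = 1.
  by rewrite !big_ord_recl big_ord0 /vec3 /= -uv; ring.
exists (range (line R 3 (vec3 a b c))); split; last exact/is_D_of_line_gap.
- split; last by apply: line_proper; apply/forall_ord3.
  split; [|exact: line_closed vu | exact: line_connected].
  rewrite -range_line_hom; split; first by exists 0 => //; rewrite raddf0.
  by move=> _ _ [x _ <-] [y _ <-]; exists (x - y) => //; rewrite raddfB.
- exists (line_hom R 3 (vec3 a b c)), (line_coord R 3 (vec3 u1 u2 u3)); split.
  + exact: line_hom_continuous.
  + exact: range_line_hom.
  + exact: line_homK vu.
  + by apply: continuous_subspaceT; exact: line_coord_continuous.
Qed.

(** * Classification of the gaps *)

Lemma gap_of_candidate (R : realFieldType) (a b c : int) (mu : R) :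
  0 < a -> 0 < b -> 0 < c -> gap _ a b c mu -> 1 / 10 < mu ->
  has_candidate a b c -> gap_value _ mu.
Proof.
move=> a0 b0 c0 G mu10 [w1 [w2 [w3 [ow [[h1 h2 h3]|[p [i [p0 h1 h2 h3 small]]]]]]]].
  by move: mu10; rewrite ltNge (gap_le_tenth _ _ _ _ _ _ _ _ a0 b0 c0 G ow).
exact: (gap_value_of_candidate _ _ _ _ _ _ _ _ _ _ a0 b0 c0 G mu10 ow p0 h1 h2 h3 small).
Qed.

Lemma large_gap (R : realFieldType) (a b c : int) (mu : R) :
  0 < a -> 0 < b -> 324 <= c -> bezout3 a b c -> gap _ a b c mu ->
    1 / 10 < mu <= 1 / 6 ->
  mu = 1 / 6 \/ gap_value _ mu.
Proof.
move=> a0 b0 c324; have c0 : 0 < c by lia.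
move=> uv G /andP[mu10 mu6].
have [[l1 [l2 [l3 [e [lv lE L3]]]]]|cand] :=
  candidate_or_short_relation a b c a0 b0 c324 uv.
  left; apply/eqP; rewrite eq_le mu6 /=.
  have := odd_relation_gap _ _ _ _ _ _ _ _ G lv (ex_intro _ e lE).
  move: L3; rewrite -(ler_int R); move: (_%:~R : R) => L; nra.
by right; exact: gap_of_candidate cand.
Qed.

(** The gap is [|x| / (2 s)] for a pair sum [s < 648 = 2 * 324], and [mu <= 1/6] keeps
    [|x| <= s]. *)
Lemma small_gap (R : realFieldType) (a b c : int) (mu : R) :
  0 < a < 324 -> 0 < b < 324 -> 0 < c < 324 -> gap _ a b c mu -> mu <= 1 / 6 ->
  exists i j : 'I_648, mu = i%:R / (2 * j%:R).
Proof.
move=> /andP[a0 a1] /andP[b0 b1] /andP[c0 c1] G mu6.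
have [x1 [x2 [x3 [ox k1 k2 k3]]]] := gap_attained _ _ _ _ _ a0 b0 c0 G.
have main (s x : int) : 0 < s < 648 -> `|x|%:~R = 2 * mu * s%:~R ->
    exists i j : 'I_648, mu = i%:R / (2 * j%:R).
  move=> /andP[s0 s1] xs.
  have s0' : 0 < s%:~R :> R by rewrite ltr0z.
  have xs' : `|x| <= s by rewrite -(ler_int R) xs; nra.
  have xn : (`|x|%N < 648)%N by lia.
  have sn : (`|s|%N < 648)%N by lia.
  exists (Ordinal xn), (Ordinal sn) => /=.
  have -> : (`|x|%N%:R : R) = 2 * mu * s%:~R by rewrite -xs -abszE.
  have -> : (`|s|%N%:R : R) = s%:~R by rewrite -[in RHS](gtr0_norm s0) -abszE.
  by field; rewrite gt_eqF.
case: (gap_le_odd_cross _ _ _ _ _ _ _ _ a0 b0 c0 G ox) => h.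
- by apply: (main (b + c) x1); [lia | apply/eqP; rewrite eq_le k1].
- by apply: (main (a + c) x2); [lia | apply/eqP; rewrite eq_le k2].
- by apply: (main (a + b) x3); [lia | apply/eqP; rewrite eq_le k3].
Qed.

(** The bound 1/6 means [3 i <= p], which keeps the rescaled [p] from falling below the start of its
    progression. *)
Lemma gap_valueP (R : realType) (mu : R) : gap_value _ mu -> mu <= 1 / 6 ->
  ([set 1 / 10 + 4 / (5 * p%:R) | p in Prog 5 7] `|`
   [set 1 / 10 + 3 / (5 * p%:R) | p in Prog 5 9]) mu.
Proof.
move=> [p [i [q [p0 i5 ipq muE]]]] mu6.
have p0' : 0 < p%:~R :> R by rewrite ltr0z.
have ip : 3 * i <= p.
  rewrite -(ler_int R) intrM; move: mu6; rewrite muE => h.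
  have : i%:~R / (5 * p%:~R) <= 1 / 15 :> R by lra.
  by rewrite ler_pdivrMr ?mulr_gt0 //; lra.
have [n pn] : exists n : nat, p = n by exists `|p|%N; lia.
rewrite muE; subst p.
have n0 : n%:R != 0 :> R by rewrite gt_eqF.
have [i1|[i2|[i3|i4]]] : i = 1 \/ i = 2 \/ i = 3 \/ i = 4 by lia.
- left; exists (4 * n)%N; first by exists ((4 * n - 7) %/ 5)%N => //; lia.
  by rewrite i1 natrM; field.
- left; exists (2 * n)%N; first by exists ((2 * n - 7) %/ 5)%N => //; lia.
  by rewrite i2 natrM; field.
- right; exists n; first by exists ((n - 9) %/ 5)%N => //; lia.
  by rewrite i3.
- left; exists n; first by exists ((n - 7) %/ 5)%N => //; lia.
  by rewrite i4.
Qed.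

Lemma gap_classification (R : realFieldType) (a b c : int) (mu : R) :
  0 < a -> 0 < b -> 0 < c -> bezout3 a b c -> gap _ a b c mu -> 1 / 10 < mu <= 1 / 6 ->
  (exists i j : 'I_648, mu = i%:R / (2 * j%:R)) \/ gap_value _ mu.
Proof.
move=> a0 b0 c0 uv G mu_bd.
have sixth : mu = 1 / 6 \/ gap_value _ mu ->
    (exists i j : 'I_648, mu = i%:R / (2 * j%:R)) \/ gap_value _ mu.
  by move=> [->|]; [left; exists (inord 1), (inord 3); rewrite !inordK //;
    field | right].
have [c1|c1] := leP 324 c; first by apply: sixth; exact: large_gap uv G mu_bd.
have [b1|b1] := leP 324 b.
  by apply: sixth; apply: (large_gap _ a c b) => //;
    [exact: bezout3C23 | exact: gapC23].
have [a1|a1] := leP 324 a.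
  apply: sixth; apply: (large_gap _ b c a) => //.
    by apply: bezout3C23; exact: bezout3C12.
  by apply: gapC23; exact: gapC12.
left; apply: (small_gap _ a b c) => //; rewrite ?a0 ?b0 ?c0 //.
by case/andP: mu_bd.
Qed.

(** * Exact gaps of the attaining lines *)

Lemma odd_cross_orthogonal (a b c w1 w2 w3 : int) : odd_cross a b c w1 w2 w3 ->
  w1 * a + w2 * b + w3 * c = 0.
Proof. by move=> [n1 [n2 [n3 [-> -> ->]]]]; ring. Qed.

(** The witness is the cross product with [m = (1, 3, 4s + 5)]. For the lower bound, [x3] is odd; if
    it is 1 or -1, orthogonality to [v] ties [x1] to [x2], and the parity of [x2] makes one of them
    large. *)
Lemma gap_1_4 (R : realFieldType) (s : nat) :
  gap R 1 4 (5 * s%:Z + 8) ((s%:Z + 3)%:~R / (2 * (5 * s%:Z + 9)%:~R)).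
Proof.
apply: (gap_fraction _ _ _ _ (4 - s%:Z) (- s%:Z - 3) 1); try lia.
  by exists 0, 1, (2 * s%:Z + 2); split; lia.
move=> x1 x2 x3 ox; have ortho := odd_cross_orthogonal _ _ _ _ _ _ ox.
have [e1 [e2 [e3 [y1 y2 y3]]]] := odd_cross_parity _ _ _ _ _ _ ox.
have [h3|h3] := leP 3 `|x3|; first by constructor 3;
  nonneg_prod (`|x3| - 3) (5 * s%:Z + 9); clear; lia.
have [h2|h2] := leP (s%:Z + 3) `|x2|; first by constructor 2;
  nonneg_prod (`|x2| - (s%:Z + 3)) (5 * s%:Z + 9); clear; lia.
have h1 : s%:Z + 4 <= `|x1|.
  have : x3 = 1 \/ x3 = -1 by lia.
  by case=> E; rewrite E in ortho; lia.
by constructor 1; nonneg_prod (`|x1| - (s%:Z + 4)) (5 * s%:Z + 9); clear; lia.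
Qed.

(** Here [m = (1, 1, 2s + 1)]. The lower bound also uses the parity of [x1], which excludes
    [|x1| = |x2| = s + 1]. *)
Lemma gap_2_3 (R : realFieldType) (s : nat) :
  gap R 2 3 (5 * s%:Z + 5) ((s%:Z + 3)%:~R / (2 * (5 * s%:Z + 7)%:~R)).
Proof.
apply: (gap_fraction _ _ _ _ (2 - s%:Z) (- s%:Z - 3) 1); try lia.
  by exists 0, 0, s%:Z; split; lia.
move=> x1 x2 x3 ox; have ortho := odd_cross_orthogonal _ _ _ _ _ _ ox.
have [e1 [e2 [e3 [y1 y2 y3]]]] := odd_cross_parity _ _ _ _ _ _ ox.
have [h3|h3] := leP 3 `|x3|; first by constructor 3;
  nonneg_prod (`|x3| - 3) (5 * s%:Z + 7); clear; lia.
have [h2|h2] := leP (s%:Z + 3) `|x2|; first by constructor 2;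
  nonneg_prod (`|x2| - (s%:Z + 3)) (5 * s%:Z + 7); clear; lia.
have h1 : s%:Z + 4 <= `|x1|.
  have : x3 = 1 \/ x3 = -1 by lia.
  by case=> E; rewrite E in ortho; lia.
by constructor 1; nonneg_prod (`|x1| - (s%:Z + 4)) (5 * s%:Z + 7); clear; lia.
Qed.

Theorem theorem1p4 (R : realType) :
  finite_set
    ((spectrum R 1 3 `&` [set m : R | 1 / 10 < m <= 1 / 6]) `+`
     ([set 1 / 10 + 4 / (5 * p%:R) | p in Prog 5 7] `|`
      [set 1 / 10 + 3 / (5 * p%:R) | p in Prog 5 9])).
Proof.
pose small := range (fun ij : 'I_648 * 'I_648 =>
  (ij.1 : nat)%:R / (2 * (ij.2 : nat)%:R) : R).
(* The term [p = 7] equals 3/14, the only value of the two progressions above 1/6. *)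
apply: (@sub_finite_set _ _ (small `|` [set 1 / 10 + 4 / (5 * 7)])); last first.
  by rewrite finite_setU; split; [exact: finite_image | exact: finite_set1].
have ratio4 (s : nat) : 1 / 10 + 4 / (5 * (5 * s + 7)%:R) =
    (s%:Z + 3)%:~R / (2 * (5 * s%:Z + 7)%:~R) :> R.
  have s0 : 0 <= s%:R :> R by [].
  rewrite !intrD intrM -!pmulrn natrD natrM; field; rewrite gt_eqF //; lra.
have ratio3 (s : nat) : 1 / 10 + 3 / (5 * (5 * s + 9)%:R) =
    (s%:Z + 3)%:~R / (2 * (5 * s%:Z + 9)%:~R) :> R.
  have s0 : 0 <= s%:R :> R by [].
  rewrite !intrD intrM -!pmulrn natrD natrM; field; rewrite gt_eqF //; lra.
have le_sixth (i p : nat) : (3 * i <= p)%N -> (0 < p)%N ->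
  1 / 10 + i%:R / (5 * p%:R) <= 1 / 6 :> R.
  move=> ip p0; have p0' : 0 < p%:R :> R by rewrite ltr0n.
  have : i%:R / (5 * p%:R) <= 1 / 15 :> R.
    rewrite ler_pdivrMr ?mulr_gt0 //.
    by move: ip; rewrite -(ler_nat R) natrM; lra.
  lra.
move=> m [[[/spectrum_gap[a [b [c [a0 b0 c0 uv G]]]] mu_bd] notB]|[mB notA]].
  left; have [[i [j ->]]|gv] := gap_classification _ _ _ _ _ a0 b0 c0 uv G mu_bd.
    by exists (i, j).
  by case: notB; apply: gap_valueP => //; case/andP: mu_bd.
have mem : m <= 1 / 6 -> spectrum R 1 3 m -> 1 / 10 < m -> False.
  by move=> m6 sm m10; apply: notA; split=> //=; rewrite m10.
case: mB => [[p [s _ <-] mE]|[p [s _ <-] mE]].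
  case: s mE => [|s] mE; first by right; rewrite -mE.
  exfalso; apply: mem.
  - by rewrite -mE; apply: le_sixth; lia.
  - rewrite -mE ratio4; apply: (gap_spectrum _ 2 3 (5 * s.+1%:Z + 5)); try by [].
    + by exists (-1), 1, 0; ring.
    exact: gap_2_3.
  - by rewrite -mE ltrDl divr_gt0 // mulr_gt0 // ltr0n; lia.
exfalso; apply: mem.
- by rewrite -mE; apply: le_sixth; lia.
- rewrite -mE ratio3; apply: (gap_spectrum _ 1 4 (5 * s%:Z + 8)); try by [].
  + by exists 1, 0, 0; ring.
  exact: gap_1_4.
- by rewrite -mE ltrDl divr_gt0 // mulr_gt0 // ltr0n; lia.
Qed.
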